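(* For every $k\geq 3$ we have $\mathrm{rhf}_{k-2}(k)\leq \mathrm{rhv}_{k-2}(k)$.
   Context: A $(1,k)$-graph is a hypergraph whose vertex set is partitioned into colors and points $V$ such that every edge contains exactly one color and exactly $k$ points; a $(1,d)$-set consists of one color and $d$ points. For a $(1,k)$-graph $R$ on $[t]\cup V$ with $|V|=t$, the relative degree of a $(1,d)$-set $S$ is $\deg_R(S)/\binom{t-d}{k-d}$, and the minimum relative $(1,d)$-degree is the minimum over all $(1,d)$-sets. The link graph $L_R(S)$ of a color or $(1,\ell)$-set $S$ is the $(k-\ell)$-graph on $V$ with edges $\{X: X\cup S\in E(R)\}$. The shadow $\partial_j(R)$ is the $(1,j)$-graph whose edges are the $(1,j)$-sets contained in edges of $R$; $\overline{\partial_j(R)}$ is its complement among all $(1,j)$-sets. $R_i:=R[\{i\}\cup V]$. Edge density of a $k$-graph on $t$ vertices is its number of edges divided by $\binom{t}{k}$. A graph (2-graph) is tightly connected if any two of its edges are joined by a tight walk (a vertex sequence whose consecutive pairs are edges). A switcher in a graph is an edge $ab$ such that $a,b$ have a common neighbour. A fractional matching of a graph $G$ is $\mathbf{w}:E(G)\to[0,1]$ with $\sum_{e\ni v}\mathbf{w}(e)\le 1$ for all $v$; its density is $\sum_e\mathbf{w}(e)/|V(G)|$. Sequentially walks, closed walks, length, sequentially tight connectivity, $\gamma$-robust matchability, the notation $\ll$, $(\alpha,\gamma,\delta)$-rainbow Hamilton frameworks and $\mathrm{rhf}_{k-2}(k)$ are as follows. A sequentially walk is a sequence of points $(v_1,\dots,v_\ell)$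 and colors $(c_1,\dots,c_{\ell-k+1})$ with $\{c_j,v_j,\dots,v_{j+k-1}\}$ an edge for all $j$; length $=\ell$; closed if its last $k-1$ points equal its first $k-1$ points. Sequentially tightly connected: any two edges are joined by a sequentially walk. An $r$-graph is $\gamma$-robustly matchable if for every $\mathbf{b}:V\to[1-\gamma,1]$ there is $\mathbf{w}:E\to[0,1]$ with $\sum_{e\ni v}\mathbf{w}(e)=\mathbf{b}(v)/(r-1)$ for all $v$. $x\ll y$ means: for every $y\in(0,1]$ there is $x_0$ such that the statements hold for all $x\le x_0$ (hierarchies read right to left). $H\subseteq R$ is an $(\alpha,\gamma,\delta)$-rainbow Hamilton framework if (F1) each $H[\{i\}\cup V]$ is sequentially tightly connected; (F2) each $H[\{i\}\cup V]$ contains a sequentially closed walk of length $1\bmod k$; (F3) $H[[t(i-1)/k+1,ti/k]\cup V]$ is $\gamma$-robustly matchable for each $i\in[k]$; (F4) for each color $i$ at least $(1-\alpha)t$ points $v$ have $\{i,v\}$ of relative $(1,1)$-degree at least $1-\delta+\gamma$ in $H$; (F5) $L_H(\{i\})$, $L_H(\{j\})$ share an edge for all $i,j$. $\mathrm{rhf}_{k-2}(k)$ is the smallest $\delta$ such that whenever $1/t\ll\varepsilon\ll\alpha\ll\gamma\ll\mu$ and $R$ on $[t]\cup V$ ($|V|=t$) has minimum relative $(1,k-2)$-degree at least $\delta+\mu$ and $I\subseteq E(R)$ has at most $\varepsilon t\binom tk$ edges, $R$ contains an $(\alpha,\gamma,\delta)$-rainbow Hamilton framework avoiding $I$. Vicinities: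 a $(k-2)$-vicinity for color $i$ is a family $\mathcal{C}_i=\{C_S\subseteq L_R(S): S\in\partial_{k-2}(R),\ i\in S\}$ (each $C_S$ a graph on $V$). An arc for $\mathcal{C}_i$ is a tuple $(i,v_1,\dots,v_{k+1})$ with $\{i,v_1,\dots,v_{k-2}\}\in\partial_{k-2}(R_i)$, $\{v_{k-1},v_k\}\in C_{\{i,v_1,\dots,v_{k-2}\}}$, $\{i,v_2,\dots,v_{k-1}\}\in\partial_{k-2}(R_i)$ and $\{v_k,v_{k+1}\}\in C_{\{i,v_2,\dots,v_{k-1}\}}$. A family $\mathcal{C}=\{\mathcal{C}_i:i\in[t]\}$ is $(\gamma,\delta)$-rainbow Hamilton if for all $S,S'\in\partial_{k-2}(R_i)$ and $T\in\partial_{k-2}(R_j)$ with $i\neq j$: (V1) $C_S$ is tightly connected; (V2) $C_S,C_{S'}$ share an edge; (V3) $C_S$ has a switcher and $\mathcal{C}_i$ has an arc; (V4) $C_S$ has a fractional matching of density $(1+1/k)(1/(k+1)+\gamma)$; (V5) $C_S$ has edge density at least $1-\delta+\gamma$; (V6) $C_S,C_T$ share an edge. A $(1,k)$-graph $R$ has $\alpha$-perturbed minimum relative $(1,k-2)$-degree at least $\delta$ if for all $j\in[k-2]$: (P1) every edge of $\partial_j(R)$ has relative degree at least $\delta$ in $R$; (P2) $\overline{\partial_j(R)}$ has edge density at most $\alpha$; (P3) every $(1,j-1)$-set of $\partial_{j-1}(R)$ has relative degree less than $\alpha$ in $\overline{\partial_j(R)}$. $\mathrm{rhv}_{k-2}(k)$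 is the smallest $\delta>0$ such that: whenever $\alpha,\gamma,\mu>0$, $t\in\mathbb{N}$ with $1/t\ll\alpha\ll\gamma\ll\mu$ and $R$ is a $(1,k)$-graph on $[t]\cup V$ ($|V|=t$) such that every $R_i$ has $\alpha$-perturbed minimum relative $(1,k-2)$-degree at least $\delta+\mu$, then $R$ admits a $(\gamma,\delta)$-rainbow Hamilton family of $(k-2)$-vicinities.
   Formalization: In rhf, robust matchability of a (1,k)-graph is required only for weightings b with k·(sum of b over colors) = (sum of b over points), and the framework H may be non-spanning: on t' ≥ (1−α)t colors and equally many points, k dividing t'. Unrepaired, rhf would equal 1. *)

(* Defs.v *)
From mathcomp Require Import all_boot all_order all_algebra.
From mathcomp Require Import classical_sets reals.

Set Implicit Arguments.
Unset Strict Implicit.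
Unset Printing Implicit Defensive.

Import Order.TTheory GRing.Theory Num.Theory.
Local Open Scope ring_scope.

(* Colors are 'I_t, i.e. [t] shifted to start at 0; points form a finType V.
   A (1,j)-set is a pair (color, j-set of points), and a (1,k)-graph on
   [t] + V is identified with its edge set. *)
Notation cset t V := ('I_t * {set V})%type.

Definition is_1kgraph (k : nat) (t : nat) (V : finType)
  (E : {set cset t V}) : Prop :=
  forall e, e \in E -> #|e.2| = k.

Definition sub_cset (t : nat) (V : finType) (s e : cset t V) : bool :=
  (e.1 == s.1) && (s.2 \subset e.2).

(* E[C + V] *)
Definition induced (t : nat) (V : finType) (E : {set cset t V})
  (C : {set 'I_t}) : {set cset t V} := [set e in E | e.1 \in C].

Definition at_color (t : nat) (V : finType) (E : {set cset t V}) (i : 'I_t)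
  : {set cset t V} := induced E [set i].

Definition deg (t : nat) (V : finType) (E : {set cset t V}) (s : cset t V)
  : nat := #|[set e in E | sub_cset s e]|.

Definition reldeg (R : realType) (k : nat) (t : nat) (V : finType)
  (E : {set cset t V}) (s : cset t V) : R :=
  (deg E s)%:R / 'C(#|V| - #|s.2|, k - #|s.2|)%:R.

Definition min_reldeg_ge (R : realType) (k d : nat) (t : nat) (V : finType)
  (E : {set cset t V}) (x : R) : Prop :=
  forall s : cset t V, #|s.2| = d -> x <= reldeg R k E s.

Definition link (k : nat) (t : nat) (V : finType) (E : {set cset t V})
  (s : cset t V) : {set {set V}} :=
  [set X : {set V} | (#|X| == k - #|s.2|)%N & (s.1, X :|: s.2) \in E].

Definition shadow (j : nat) (t : nat) (V : finType) (E : {set cset t V})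
  : {set cset t V} :=
  [set s : cset t V | (#|s.2| == j) && [exists e in E, sub_cset s e]].

(* Complement of the shadow among the (1,j)-sets with color in C. *)
Definition coshadow (j : nat) (t : nat) (V : finType) (C : {set 'I_t})
  (E : {set cset t V}) : {set cset t V} :=
  [set s : cset t V | (s.1 \in C) && (#|s.2| == j)] :\: shadow j E.

Definition share_edge (V : finType) (G G' : {set {set V}}) : Prop :=
  exists X, X \in G /\ X \in G'.

(** Walks *)

(* The set of the n consecutive entries of s that start at index j. *)
Definition window (n j : nat) (V : finType) (s : seq V) : {set V} :=
  [set v in take n (drop j s)].

Definition windows (n : nat) (V : finType) (s : seq V) : seq {set V} :=
  [seq window n j s | j <- iota 0 (size s - n).+1].

Definition walk_edges (k : nat) (t : nat) (V : finType)
  (s : seq V) (cs : seq 'I_t) : seq (cset t V) := zip cs (windows k s).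

Definition seq_walk (k : nat) (t : nat) (V : finType) (E : {set cset t V})
  (s : seq V) (cs : seq 'I_t) : Prop :=
  [/\ (k <= size s)%N, size cs = (size s - k).+1
    & {subset walk_edges k s cs <= E}].

Definition closed_walk (k : nat) (V : finType) (s : seq V) : Prop :=
  drop (size s - k.-1) s = take k.-1 s.

Definition seq_tightly_connected (k : nat) (t : nat) (V : finType)
  (E : {set cset t V}) : Prop :=
  forall e f, e \in E -> f \in E ->
  exists (s : seq V) (cs : seq 'I_t) (p : seq (cset t V)),
    [/\ seq_walk k E s cs, walk_edges k s cs = e :: p & last e p = f].

(** Hierarchies of constants: 1/t << x << y is read from right to left. *)

Definition for_small (R : realType) (P : R -> Prop) : Prop :=
  exists2 x0 : R, 0 < x0 <= 1 & forall x : R, 0 < x <= x0 -> P x.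

Definition for_large (R : realType) (P : nat -> Prop) : Prop :=
  exists2 x0 : R, 0 < x0 <= 1 &
    forall t : nat, (0 < t)%N -> t%:R^-1 <= x0 -> P t.

(** Rainbow Hamilton frameworks *)

(* A (1,k)-graph on C + V is a (k+1)-graph, whence the factor 1/k.  Summing the
   color equations and the point equations gives
   sum_(c in C) b(c) = k^-1 * sum_v b(v), as each edge has one color and k
   points.  Only weightings satisfying this identity can be realized, so the
   quantification is over these; over all weightings with values in
   [1 - gamma, 1] the property would fail for every graph with points. *)
Definition robustly_matchable (R : realType) (k : nat) (t : nat) (V : finType)
  (E : {set cset t V}) (C : {set 'I_t}) (gamma : R) : Prop :=
  forall (bc : 'I_t -> R) (bv : V -> R),
    (forall c, c \in C -> 1 - gamma <= bc c <= 1) ->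
    (forall v, 1 - gamma <= bv v <= 1) ->
    k%:R * (\sum_(c in C) bc c) = \sum_v bv v ->
  exists w : cset t V -> R,
    [/\ forall e, e \in E -> 0 <= w e <= 1,
        forall c, c \in C -> \sum_(e in E | e.1 == c) w e = bc c / k%:R
      & forall v, \sum_(e in E | v \in e.2) w e = bv v / k%:R].

(* The interval [t(i-1)/k + 1, ti/k] for i in [k], with colors and i shifted to
   start at 0. *)
Definition color_block (k t : nat) (i : 'I_k) : {set 'I_t} :=
  [set c : 'I_t | (t * i <= k * c)%N && (k * c.+1 <= t * i.+1)%N].

Definition rainbow_framework (R : realType) (k : nat) (t : nat) (V : finType)
  (H : {set cset t V}) (alpha gamma delta : R) : Prop :=
  [/\ forall i, seq_tightly_connected k (at_color H i),
      forall i, exists (s : seq V) (cs : seq 'I_t),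
        [/\ seq_walk k (at_color H i) s cs, closed_walk k s
          & size s = 1 %[mod k]],
      (k %| t)%N /\ forall i : 'I_k,
        robustly_matchable k (induced H (color_block t i)) (color_block t i)
          gamma,
      forall i, (1 - alpha) * t%:R <=
        #|[set v : V | 1 - delta + gamma <= reldeg R k H (i, [set v])]|%:R
    & forall i j, share_edge (link k H (i, finset.set0))
                             (link k H (j, finset.set0))].

(* E contains a framework avoiding I.  The framework need not span [t] + V,
   since I may comprise all edges at some color or point: it lives on t' colors
   (relabelled by 'I_t' in increasing order) and t' points, where t' is at least
   (1 - alpha)t. *)
Definition contains_framework (R : realType) (k : nat) (t : nat) (V : finType)
  (E I : {set cset t V}) (alpha gamma delta : R) : Prop :=
  exists (t' : nat) (V' : finType) (f : 'I_t' -> 'I_t) (g : V' -> V)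
         (H : {set cset t' V'}),
    [/\ (1 - alpha) * t%:R <= t'%:R :> R /\ #|V'| = t',
        (forall c d : 'I_t', (c < d)%N -> (f c < f d)%N) /\ injective g,
        is_1kgraph k H,
        forall e, e \in H -> (f e.1, g @: e.2) \in E :\: I
      & rainbow_framework k H alpha gamma delta].

Definition rhf_property (R : realType) (k : nat) (delta : R) : Prop :=
  forall mu : R, 0 < mu <= 1 ->
  for_small (fun gamma : R =>
  for_small (fun alpha : R =>
  for_small (fun eps : R =>
  for_large R (fun t : nat =>
  forall (V : finType) (E I : {set cset t V}),
    #|V| = t -> is_1kgraph k E ->
    min_reldeg_ge k (k - 2) E (delta + mu) ->
    I \subset E -> #|I|%:R <= eps * t%:R * 'C(t, k)%:R ->
    contains_framework k E I alpha gamma delta)))).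

(* For k >= 3 the set contains 1 (no graph has relative degrees above 1) and
   only positive numbers (by the degree condition in [rainbow_framework]), so
   this is a genuine infimum. *)
Definition rhf (R : realType) (k : nat) : R :=
  inf [set delta : R | rhf_property k delta].

(** Rainbow Hamilton families of vicinities *)

Definition tightly_connected2 (V : finType) (G : {set {set V}}) : Prop :=
  forall e f, e \in G -> f \in G ->
  exists (s : seq V) (p : seq {set V}),
    [/\ (2 <= size s)%N, {subset windows 2 s <= G},
        windows 2 s = e :: p & last e p = f].

Definition has_switcher (V : finType) (G : {set {set V}}) : Prop :=
  exists a b c : V,
    [/\ [set a; b] \in G, [set a; c] \in G & [set b; c] \in G].

Definition fractional_matching (R : realType) (V : finType)
  (G : {set {set V}}) (w : {set V} -> R) : Prop :=
  (forall e, e \in G -> 0 <= w e <= 1) /\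
  (forall v, \sum_(e in G | v \in e) w e <= 1).

Definition matching_density (R : realType) (V : finType) (G : {set {set V}})
  (w : {set V} -> R) : R := (\sum_(e in G) w e) / #|V|%:R.

Definition edge_density2 (R : realType) (V : finType) (G : {set {set V}}) : R :=
  #|G|%:R / 'C(#|V|, 2)%:R.

(* A family {C_i : i in [t]} of (k-2)-vicinities is a single function on
   (1,k-2)-sets, where C (i, S) is the graph C_{S + i} of the vicinity C_i;
   only its values on the shadow matter. *)
Definition vicinity_family (k : nat) (t : nat) (V : finType)
  (E : {set cset t V}) (C : cset t V -> {set {set V}}) : Prop :=
  forall s, s \in shadow (k - 2) E -> C s \subset link k E s.

Definition is_arc (k : nat) (t : nat) (V : finType) (E : {set cset t V})
  (C : cset t V -> {set {set V}}) (i : 'I_t) (vs : seq V) : Prop :=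
  let S1 := (i, window (k - 2) 0 vs) in
  let S2 := (i, window (k - 2) 1 vs) in
  size vs = k.+1 /\
  [/\ S1 \in shadow (k - 2) (at_color E i), window 2 (k - 2) vs \in C S1,
      S2 \in shadow (k - 2) (at_color E i) & window 2 (k - 1) vs \in C S2].

Definition rainbow_hamilton_family (R : realType) (k : nat) (t : nat)
  (V : finType) (E : {set cset t V}) (C : cset t V -> {set {set V}})
  (gamma delta : R) : Prop :=
  let dE i := shadow (k - 2) (at_color E i) in
  [/\ forall i S, S \in dE i -> tightly_connected2 (C S),
      forall i S S', S \in dE i -> S' \in dE i -> share_edge (C S) (C S'),
      (forall i S, S \in dE i -> has_switcher (C S)) /\
      (forall i, exists vs, is_arc k E C i vs),
      forall i S, S \in dE i -> exists2 w : {set V} -> R,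
        fractional_matching (C S) w &
        matching_density (C S) w = (1 + k%:R^-1) * (k.+1%:R^-1 + gamma)
    & (forall i S, S \in dE i -> 1 - delta + gamma <= edge_density2 R (C S)) /\
      (forall i j S T, i != j -> S \in dE i -> T \in dE j ->
         share_edge (C S) (C T))].

(* alpha-perturbed minimum relative (1,k-2)-degree at least delta of a
   (1,k)-graph on C + V.  A (1,j)-graph on C + V has at most #|C| * 'C(#|V|, j)
   edges, which is what its edge density is relative to. *)
Definition perturbed_min_reldeg_ge (R : realType) (k : nat) (t : nat)
  (V : finType) (C : {set 'I_t}) (E : {set cset t V}) (alpha delta : R)
  : Prop :=
  forall j, (1 <= j <= k - 2)%N ->
  [/\ forall s, s \in shadow j E -> delta <= reldeg R k E s,
      #|coshadow j C E|%:R / (#|C| * 'C(#|V|, j))%:R <= alpha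
    & forall s, s \in shadow j.-1 E -> reldeg R j (coshadow j C E) s < alpha].

Definition rhv_property (R : realType) (k : nat) (delta : R) : Prop :=
  forall mu : R, 0 < mu <= 1 ->
  for_small (fun gamma : R =>
  for_small (fun alpha : R =>
  for_large R (fun t : nat =>
  forall (V : finType) (E : {set cset t V}),
    #|V| = t -> is_1kgraph k E ->
    (forall i, perturbed_min_reldeg_ge k [set i] (at_color E i) alpha
                 (delta + mu)) ->
    exists2 C : cset t V -> {set {set V}},
      vicinity_family k E C & rainbow_hamilton_family k E C gamma delta))).

(* For k >= 3 the set contains 1, so this is a genuine infimum. *)
Definition rhv (R : realType) (k : nat) : R :=
  inf [set delta : R | 0 < delta /\ rhv_property k delta].

(* Main.v *)
(* Fix a color [i].  Call a point set clean if none of its subsets of size at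
   most k-2 lies in unusually many edges of [I] at color [i]; clean sets have few
   unclean one-point extensions.  After discarding the few colors with many edges
   in [I] and the few points that are unclean for many colors, the edges outside
   [I] with clean point sets form a graph whose shadows are exactly the families
   of clean sets, and averaging over clean extensions shows that it has perturbed
   minimum degree.  It thus admits a rainbow Hamilton family of vicinities [C],
   and the edges [S :|: e] with [S] clean and [e] in [C (i, S)] form a framework
   [H].

   Walks in [H] are built from changes of a single coordinate of an ordered edge,
   which take [k] steps: inside one vicinity the switcher makes the graph on
   ordered edges connected, and vicinities with adjacent clean sets share an edge.
   As this costs 0 modulo [k] steps, the single step given by an arc, taken twice,
   yields the closed walk.  Robust matchability is dualized by Farkas' lemma; a
   dual solution is bounded by the vicinity of a clean set of points of low
   weight, whose matching has density above 1/k. *)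
Require Import Defs.
From mathcomp Require Import all_boot all_order all_algebra.
From mathcomp Require Import boolp reals.
From mathcomp Require Import zify ring lra.

Set Implicit Arguments.
Unset Strict Implicit.
Unset Printing Implicit Defensive.

Import Order.TTheory GRing.Theory Num.Theory.
Local Open Scope ring_scope.

(** * Farkas' lemma *)

(* Bartl's induction on the number of inequalities: when the last one is needed,
   a violator x0 of the claim for the others is used to project it away. *)
Lemma farkas (R : realFieldType) (D : finType) (I : eqType) (s : seq I)
    (a : I -> D -> R) (g : D -> R) :
  uniq s ->
  (forall x : D -> R, (forall i, i \in s -> \sum_d a i d * x d <= 0) ->
     \sum_d g d * x d <= 0) ->
  exists2 u : I -> R, (forall i, 0 <= u i) &
    forall d, g d = \sum_(i <- s) u i * a i d.
Proof.
elim: s a g => [|i0 s IH] a g.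
  move=> _ gle; exists (fun=> 0) => // d; rewrite big_nil; apply/eqP.
  have := gle g (fun _ => ltac:(by [])).
  have sq_ge0 d' : true -> 0 <= g d' * g d' by rewrite -expr2 sqr_ge0.
  move=> le0; have /eqP : \sum_d g d * g d = 0.
    by apply/eqP; rewrite eq_le le0 sumr_ge0.
  rewrite psumr_eq0 => [/allP/(_ d)|d' _]; last exact: sq_ge0.
  by rewrite mem_index_enum mulf_eq0 orbb; apply.
move=> /= /andP[i0s us] gle.
have [suff_s|] := pselect (forall x : D -> R,
    (forall i, i \in s -> \sum_d a i d * x d <= 0) -> \sum_d g d * x d <= 0).
  have [u u0 ug] := IH a g us suff_s.
  exists (fun i => if i == i0 then 0 else u i) => [i|d]; first by case: eqP.
  rewrite big_cons eqxx mul0r add0r ug; apply: eq_big_seq => i si.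
  by case: eqP => // ii0; rewrite -ii0 si in i0s.
move=> /existsNP[x0 /not_implyP[ax0 /negP]]; rewrite -ltNge => gx0.
have ai0x0 : 0 < \sum_d a i0 d * x0 d.
  rewrite ltNge; apply/negP => ai0; move: gx0; rewrite ltNge => /negP; apply.
  by apply: gle => i; rewrite inE => /orP[/eqP-> //|]; exact: ax0.
set n0 := \sum_d a i0 d * x0 d in ai0x0.
pose f (h : D -> R) := \sum_d h d * x0 d / n0.
have fE h : f h = (\sum_d h d * x0 d) / n0 by rewrite /f mulr_suml.
(* Subtracting a multiple of [a i0] makes each functional vanish at [x0]; by [pE] this amounts to
   moving [x] along [x0] onto the hyperplane where [a i0] vanishes. *)
pose p (h : D -> R) d := h d - f h * a i0 d.
have pE h x : \sum_d p h d * x d =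
    \sum_d h d * (x d - (\sum_d a i0 d * x d) / n0 * x0 d).
  set q := \sum_d a i0 d * x d.
  transitivity (\sum_d h d * x d - f h * q).
    rewrite /q mulr_sumr -sumrB; apply: eq_bigr => d _; rewrite /p; ring.
  transitivity (\sum_d h d * x d - (\sum_d h d * x0 d) * (q / n0)).
    by rewrite fE; ring.
  rewrite mulr_suml -sumrB; apply: eq_bigr => d _; ring.
have [|u u0 ug] := IH (fun i => p (a i)) (p g) us.
  move=> x ax; rewrite pE; apply: gle => i; rewrite inE => /orP[/eqP->|si].
    set q := \sum_d a i0 d * x d.
    have -> : \sum_d a i0 d * (x d - q / n0 * x0 d) =
       q - (\sum_d a i0 d * x0 d) * (q / n0).
      rewrite mulr_suml -sumrB; apply: eq_bigr => d _; ring.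
    by rewrite -/n0 mulrCA divff ?gt_eqF// mulr1 subrr.
  by rewrite -pE; exact: ax.
(* Nonnegative, since [x0] makes [g] positive and every [a i] with [i \in s] nonpositive. *)
pose u' := f g - \sum_(i <- s) u i * f (a i).
exists (fun i => if i == i0 then u' else u i) => [i|d].
  case: eqP => // _; rewrite subr_ge0; apply: (@le_trans _ _ 0).
    rewrite big_seq; apply: sumr_le0 => j js; apply: mulr_ge0_le0 => //.
    by rewrite fE; apply: mulr_le0_ge0; [exact: ax0|rewrite invr_ge0 ltW].
  by rewrite fE divr_ge0// ltW.
rewrite big_cons eqxx (_ : \sum_(j <- s) _ = \sum_(j <- s) u j * a j d).
  have /eqP := ug d; rewrite {1}/p subr_eq => /eqP ->.
  rewrite /u' mulrBl addrC -addrA; congr (_ + _).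
  by rewrite mulr_suml -sumrN -big_split /=; apply: eq_bigr => i _; rewrite /p;
    ring.
by apply: eq_big_seq => i si; case: eqP => // ii0; rewrite -ii0 si in i0s.
Qed.

(** * Tight walks *)

Definition tight_walk (k : nat) (V : finType) (G : {set {set V}}) (s : seq V) :=
  forall j, (j + k <= size s)%N -> window k j s \in G.

(** Between lists of length [k], divisibility of [size M] means that the window is shifted by a
    multiple of [k], which keeps lengths modulo [k] under control. *)
Definition reach (k : nat) (V : finType) (G : {set {set V}}) (x y : seq V) :=
  exists M, (k %| size M)%N /\ tight_walk k G (x ++ M ++ y).

Section TightWalks.

Variables (k : nat) (V : finType).
Implicit Types (G : {set {set V}}) (s x y z r : seq V).

Lemma window_catl n j s r :
  (j + n <= size s)%N -> window n j (s ++ r) = window n j s.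
Proof.
move=> jn; rewrite /window; congr [set v in _].
rewrite drop_cat; case: ltnP => js; last first.
  have n0 : n = 0%N by lia.
  by rewrite n0 !take0.
rewrite takel_cat// size_drop; lia.
Qed.

Lemma window_catr n j s r : window n (size s + j) (s ++ r) = window n j r.
Proof.
rewrite /window drop_cat; case: ltnP => js; last by rewrite addKn.
by rewrite ltnNge leq_addr in js.
Qed.

(** The overlap [z] is so long that a window starting in [s] ends before [r]; all others lie in
    [z ++ r]. *)
Lemma tight_walk_glue G s z r : (0 < k)%N -> (k.-1 <= size z)%N ->
  tight_walk k G (s ++ z) -> tight_walk k G (z ++ r) ->
  tight_walk k G (s ++ z ++ r).
Proof.
move=> k0 kz sz zr j; case: (ltnP j (size s)) => js jk.
  rewrite catA window_catl; first by apply: sz; rewrite size_cat; lia.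
  by rewrite size_cat; lia.
rewrite -(subnKC js) window_catr; apply: zr.
by move: jk; rewrite !size_cat; lia.
Qed.

Lemma reach_trans G x y z : (0 < k)%N -> size y = k ->
  reach k G x y -> reach k G y z -> reach k G x z.
Proof.
move=> k0 sy [M [kM xMy]] [M' [kM' yMz]].
exists (M ++ y ++ M'); split.
  by rewrite !size_cat sy; do 2?[rewrite dvdn_addr//].
rewrite (_ : _ ++ _ = (x ++ M) ++ y ++ (M' ++ z)); last by rewrite !catA.
by apply: tight_walk_glue => //; rewrite ?sy ?leq_pred// -catA.
Qed.

(** A window of length [k] meets each coordinate exactly once. It forms the first edge if it starts
    at or before the changed coordinate, and the second edge otherwise. *)
Lemma tight_walk_change G (A B : seq V) u w :
  size (A ++ u :: B) = k ->
  [set v in A ++ u :: B] \in G -> [set v in A ++ w :: B] \in G ->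
  tight_walk k G ((A ++ u :: B) ++ (A ++ w :: B)).
Proof.
move=> sx xG yG j; rewrite size_cat => jk.
have sy : size (A ++ w :: B) = k by rewrite -sx !size_cat.
have jlek : (j <= k)%N by lia.
have -> : window k j ((A ++ u :: B) ++ A ++ w :: B) =
    [set v in drop j (A ++ u :: B) ++ take j (A ++ w :: B)].
  rewrite /window; congr [set v in _]; rewrite drop_cat sx; case: ltnP => jk'.
    rewrite take_cat size_drop sx ifF; last by apply/negbTE;
      rewrite -leqNgt leq_subr.
    by rewrite subKn.
  have -> : j = k by lia.
  by rewrite subnn drop0 -sx drop_size.
case: (leqP j (size A)) => jA.
  rewrite (_ : [set v in _] = [set v in A ++ u :: B])// -setP => v.
  rewrite !inE -[in RHS](cat_take_drop j A) !mem_cat drop_cat take_cat.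
  case: ltnP => [_|Aj]; first by rewrite !mem_cat; do !case: (_ \in _).
  have -> : j = size A by lia.
  by rewrite subnn drop0 take0 cats0 take_size drop_size in_nil orbF orbC.
rewrite (_ : [set v in _] = [set v in A ++ w :: B])// -setP => v.
have -> : j = (size A + (j - size A).-1.+1)%N by lia.
set i := _.-1; rewrite !inE drop_cat take_cat ltnNge leq_addr /= addKn /=.
rewrite -[in RHS](cat_take_drop i B) !mem_cat !inE !mem_cat.
by do !case: (_ \in _); rewrite ?orbT ?orbF.
Qed.

Lemma reach_change G (A B : seq V) u w :
  size (A ++ u :: B) = k ->
  [set v in A ++ u :: B] \in G -> [set v in A ++ w :: B] \in G ->
  reach k G (A ++ u :: B) (A ++ w :: B).
Proof. by move=> *; exists [::]; split=> //; exact: tight_walk_change. Qed.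

End TightWalks.

(** * Connectivity of ordered edges *)

Section OrderedEdges.

Variables (V : finType) (G : {set {set V}}).

(* The graph on ordered edges: non-bipartite connected graphs have a connected
   bipartite double cover. *)
Definition shares_end : rel (V * V) := fun p q =>
  [&& [set p.1; p.2] \in G, [set q.1;
    q.2] \in G & (p.1 == q.1) || (p.2 == q.2)].

Lemma shares_end_sym : symmetric shares_end.
Proof.
by move=> p q; rewrite /shares_end andbCA; do 2!congr (_ && _);
  rewrite ![_ == q.1]eq_sym ![_ == q.2]eq_sym.
Qed.

Let cs : connect_sym shares_end := sym_connect_sym shares_end_sym.

Definition flip (p : V * V) := (p.2, p.1).

Lemma connect_flip p q :
  connect shares_end p q -> connect shares_end (flip p) (flip q).
Proof.
case/connectP => s; elim: s p => [|r s IH] p /=; first by move=> _ ->.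
case/andP=> pr rs ql; apply: (connect_trans _ (IH r rs ql)).
apply: connect1; move: pr; rewrite /shares_end /=.
by rewrite ![[set p.2; _]]setUC ![[set r.2; _]]setUC orbC.
Qed.

Lemma windows2_cons (u v : V) s :
  windows 2 (u :: v :: s) =
  if s is [::] then [:: [set u; v]] else [set u; v] :: windows 2 (v :: s).
Proof.
have w0 r : window 2 0 (u :: v :: r) = [set u; v].
  by rewrite /window /= take0; apply/setP=> x; rewrite !inE.
case: s => [|w s]; first by rewrite /windows /= w0.
rewrite /windows /=; congr cons; first exact: w0.
congr cons; rewrite subn2 /= (iotaDl 2 0) (iotaDl 1 0) -!map_comp.
by apply: eq_map => j.
Qed.

(** Consecutive edges [uv] and [vw] give the ordered edges [(u, v)] and [(w, v)], which share an
    end. The orientation flips at each step, so the order of the final edge is left open. *)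
Lemma walk_connect s u v (f : {set V}) : {subset windows 2 (u :: v :: s) <= G}
  ->
  last set0 (windows 2 (u :: v :: s)) = f ->
  exists c d, [/\ f = [set c; d] & connect shares_end (u, v) (c, d)].
Proof.
elim: s u v => [|w s IH] u v sub lst.
  by exists u, v; split => //; rewrite -lst windows2_cons.
have subvw : {subset windows 2 (v :: w :: s) <= G}.
  by move=> e; rewrite windows2_cons in sub => he; apply: sub;
    rewrite inE he orbT.
have lst' : last set0 (windows 2 (v :: w :: s)) = f.
  by rewrite -lst (windows2_cons u) (windows2_cons v); case: (s).
have [c [d [fE con]]] := IH v w subvw lst'.
exists d, c; split; first by rewrite setUC.
apply: (connect_trans _ (connect_flip con)); apply: connect1.
rewrite /shares_end /= eqxx orbT andbT; apply/andP; split.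
  by apply: sub; rewrite windows2_cons mem_head.
by apply: subvw; rewrite windows2_cons setUC; case: (s) => [|? ?];
  rewrite mem_head.
Qed.

Lemma tightly_connected_connect a b c d : tightly_connected2 G ->
  [set a; b] \in G -> [set c; d] \in G ->
  connect shares_end (a, b) (c, d) \/ connect shares_end (a, b) (d, c).
Proof.
have set2E (x y x' y' : V) : [set x; y] = [set x'; y'] ->
    (x = x' /\ y = y') \/ (x = y' /\ y = x').
  move=> E; have := set21 x y; rewrite E => /set2P[xE|xE].
    left; split=> //; have := set22 x y; rewrite E => /set2P[yE|//].
    by have := set22 x' y'; rewrite -E xE yE => /set2P[].
  right; split=> //; have := set22 x y; rewrite E => /set2P[//|yE].
  by have := set21 x' y'; rewrite -E xE yE => /set2P[].
move=> tc ab cd; have [s [p [s2 sub sE lE]]] := tc _ _ ab cd.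
case: s s2 sub sE => [|u [|v s]]// _ sub sE.
have uv : [set a; b] = [set u; v].
  by move: sE; rewrite windows2_cons; case: (s) => [|? ?] [->].
have lst : last set0 (windows 2 (u :: v :: s)) = [set c; d] by rewrite sE /= lE.
have [c' [d' [E con]]] := walk_connect sub lst.
have main : connect shares_end (u, v) (c, d) \/ connect shares_end (u, v) (d,
  c).
  by case: (set2E _ _ _ _ E) => -[-> ->]; [left|right].
case: (set2E _ _ _ _ uv) => -[-> ->] //.
by case: main => /connect_flip; [right|left].
Qed.

(** The triangle of the switcher reverses an ordered edge by [(x, y)], [(z, y)], [(z, x)], [(y, x)],
    which removes the ambiguity of orientation left by tight connectivity. *)
Lemma switcher_connect a b c d : tightly_connected2 G -> has_switcher G ->
  [set a; b] \in G -> [set c; d] \in G -> connect shares_end (a, b) (c, d).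
Proof.
move=> tc [x [y [z [xy xz yz]]]] ab cd.
have flipxy : connect shares_end (x, y) (y, x).
  apply: (@connect_trans _ _ (z, y)).
    by apply: connect1; rewrite /shares_end /= xy setUC yz eqxx orbT.
  apply: (@connect_trans _ _ (z, x)).
    by apply: connect1; rewrite /shares_end /= setUC yz setUC xz eqxx.
  by apply: connect1; rewrite /shares_end /= setUC xz setUC xy eqxx orbT.
have to_xy p q : [set p; q] \in G -> connect shares_end (p, q) (x, y).
  move=> pq; case: (tightly_connected_connect tc pq xy) => // /connect_trans;
    apply.
  by rewrite cs.
by apply: (connect_trans (to_xy _ _ ab)); rewrite cs; exact: to_xy.
Qed.

End OrderedEdges.

(** * Clean sets and ordered edges *)

(** Points of [L] are added one at a time: at each stage at most [b] of them are bad and fewer than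
    [d] are already used. *)
Lemma greedy_extension (T : finType) (P : {set T} -> bool) (L X : {set T}) (b d
  : nat) :
  (forall Y : {set T}, X \subset Y -> (#|Y| < d)%N -> P Y ->
     (#|[set a | ~~ P (a |: Y)]| <= b)%N) ->
  P X -> (#|X| <= d)%N -> (b + d <= #|L|)%N ->
  exists Y : {set T}, [/\ X \subset Y, Y \subset X :|: L, #|Y| = d & P Y].
Proof.
move=> ext PX Xd bL.
have {Xd} [n dE] : exists n, d = (#|X| + n)%N.
  by exists (d - #|X|)%N; rewrite subnKC.
elim: n X dE ext PX => [|n IH] X dE ext PX.
  by exists X; rewrite dE addn0 subsetUl.
have [a /setDP[aL]] : exists a, a \in L :\: (X :|: [set a | ~~ P (a |: X)]).
  apply/set0Pn; rewrite -card_gt0 cardsD subn_gt0.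
  apply: leq_ltn_trans (subset_leq_card (subsetIr _ _)) _.
  apply: leq_ltn_trans (leq_card_setU _ _) _.
  have := ext X (subxx _) _ PX; lia.
rewrite !inE negb_or negbK => /andP[aX Pa].
have [||//|Y [XY YL Yd PY]] := IH (a |: X).
- by rewrite cardsU1 aX; lia.
- by move=> Y XY; apply: ext; apply: subset_trans XY; exact: subsetUr.
exists Y; split => //; first by apply: subset_trans XY; exact: subsetUr.
apply: subset_trans YL _; rewrite -setUA subUset sub1set !inE aL orbT /=.
exact: subxx.
Qed.

(** Isolates what the arguments use about clean sets, so that they apply to one color or, by
    [clean_systemI], to two colors at once. *)
Definition clean_system (V : finType) (m b : nat) (cl : {set V} -> bool) :=
  [/\ cl set0, forall X Y : {set V}, X \subset Y -> cl Y -> cl X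
    & forall X : {set V}, (#|X| < m)%N -> cl X ->
        (#|[set a | ~~ cl (a |: X)]| <= b)%N].

Lemma clean_systemI (V : finType) (m b : nat) (cl cl' : {set V} -> bool) :
  clean_system m b cl -> clean_system m b cl' ->
  clean_system m (b + b) (fun X => cl X && cl' X).
Proof.
move=> [c0 cS cE] [c0' cS' cE']; split; first by rewrite /= c0 c0'.
  by move=> X Y XY /andP[/= /(cS _ _ XY)-> /(cS' _ _ XY)->].
move=> X Xm /andP[cX cX'].
apply: leq_trans (leq_add (cE X Xm cX) (cE' X Xm cX')).
apply: leq_trans (leq_card_setU _ _); apply: subset_leq_card.
by apply/subsetP => a; rewrite !inE negb_and.
Qed.

(** * Walks between ordered edges of different vicinities *)

Section OrderedTuples.

Variables (V : finType) (m b : nat) (cl : {set V} -> bool).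
Variables (C : {set V} -> {set {set V}}) (G : {set {set V}}).
Hypothesis cl_sys : clean_system m b cl.
Hypothesis V_large : (b + b + m + m.+1 <= #|V|)%N.
Let good (S : {set V}) := cl S /\ #|S| = m.
Hypothesis C_edge : forall S e, good S -> e \in C S -> #|e| = 2.
Hypothesis C_G : forall S e, good S -> e \in C S -> S :|: e \in G.
Hypothesis C_conn : forall S, good S -> tightly_connected2 (C S).
Hypothesis C_switch : forall S, good S -> has_switcher (C S).
Hypothesis C_share : forall S S', good S -> good S' -> share_edge (C S) (C S').

Let ordered (s : seq V) := [/\ size s = m, uniq s & cl [set v in s]].

Let ordered_good s : ordered s -> good [set v in s].
Proof. by case=> ss us cs; split=> //; rewrite cardsE (card_uniqP us). Qed.

Let set_cat2 (s : seq V) x y : [set v in s ++ [:: x;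
  y]] = [set v in s] :|: [set x; y].
Proof. by apply/setP => v; rewrite !inE mem_cat !inE. Qed.

Let reach_connect s p q : ordered s -> [set p.1; p.2] \in C [set v in s] ->
  connect (shares_end (C [set v in s])) p q ->
  reach m.+2 G (s ++ [:: p.1; p.2]) (s ++ [:: q.1; q.2]).
Proof.
move=> os pC; have gs := ordered_good os.
have sz x y : size (s ++ [:: x; y]) = m.+2.
  by case: os => ss _ _; rewrite size_cat ss addn2.
have inG x y : [set x; y] \in C [set v in s] -> [set v in s ++ [:: x; y]] \in G.
  by rewrite set_cat2; exact: C_G.
have change1 x y z : [set x; y] \in C [set v in s] ->
    [set z; y] \in C [set v in s] ->
    reach m.+2 G (s ++ [:: x; y]) (s ++ [:: z; y]).
  by move=> xy zy; apply: reach_change; rewrite ?sz ?inG.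
have change2 x y z : [set x; y] \in C [set v in s] ->
    [set x; z] \in C [set v in s] ->
    reach m.+2 G (s ++ [:: x; y]) (s ++ [:: x; z]).
  move=> xy xz; rewrite -!(cat_rcons x); apply: reach_change;
  by rewrite ?cat_rcons ?sz ?inG.
case/connectP => t; elim: t p pC => [|r t IH] p pC /=.
  by move=> _ ->; exact: change1.
case/andP=> /and3P[_ rC pr] rt qE; apply: (reach_trans _ (sz r.1 r.2)) => //;
  last first.
  exact: IH.
case: p r pC rC pr {IH rt qE} => [x y] [x' y'] /= pC rC /orP[/eqP E|/eqP E].
  by rewrite -E in rC *; exact: change2.
by rewrite -E in rC *; exact: change1.
Qed.

(** Induction on the length of the differing suffix. To replace [x] by [x'], the suffix after [x] is
    first turned into a set [W] that is clean with both prefixes, then [x] is exchanged, and finally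
    [W] is turned into the target suffix. *)
Lemma reach_ordered s s' a c a' c' : ordered s -> ordered s' ->
  [set a; c] \in C [set v in s] -> [set a'; c'] \in C [set v in s'] ->
  reach m.+2 G (s ++ [:: a; c]) (s' ++ [:: a'; c']).
Proof.
have fixed t x y x' y' : ordered t -> [set x; y] \in C [set v in t] ->
    [set x'; y'] \in C [set v in t] ->
    reach m.+2 G (t ++ [:: x; y]) (t ++ [:: x'; y']).
  move=> ot xy xy'; apply: (@reach_connect t (x, y) (x', y')) => //.
  have gt := ordered_good ot.
  by apply: switcher_connect => //; [exact: C_conn|exact: C_switch].
have sz t x y : ordered t -> size (t ++ [:: x; y]) = m.+2.
  by case=> ss _ _; rewrite size_cat ss addn2.
(* A common edge [{p, q}] of the two vicinities lets one entry change: go to [(p, q)] in the first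
   vicinity, exchange [z] for [z'], and leave [(p, q)] in the second. *)
have change u w z z' x y x' y' : ordered (u ++ z :: w) -> ordered (u ++ z' ::
  w) ->
    [set x; y] \in C [set v in u ++ z :: w] ->
    [set x'; y'] \in C [set v in u ++ z' :: w] ->
    reach m.+2 G ((u ++ z :: w) ++ [:: x; y]) ((u ++ z' :: w) ++ [:: x'; y']).
  move=> o1 o2 xy xy'; have [g1 g2] := (ordered_good o1, ordered_good o2).
  have [e [e1 e2]] := C_share g1 g2.
  have /eqP/cards2P[p [q [_ eE]]] := C_edge g1 e1.
  rewrite {}eE in e1 e2.
  apply: (reach_trans _ (sz _ p q o1)) => //; first exact: fixed.
  apply: (reach_trans _ (sz _ p q o2)) => //; last exact: fixed.
  rewrite -!catA !cat_cons; apply: reach_change;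
    rewrite -?cat_cons ?catA ?sz ?set_cat2 //; exact: C_G.
suff main n : forall u r r' a c a' c', size r = n -> size r' = n ->
    ordered (u ++ r) -> ordered (u ++ r') ->
    [set a; c] \in C [set v in u ++ r] -> [set a';
      c'] \in C [set v in u ++ r'] ->
    reach m.+2 G ((u ++ r) ++ [:: a; c]) ((u ++ r') ++ [:: a'; c']).
  by move=> os os'; apply: (main m [::]) => //; [case: os|case: os'].
elim: n => [|n IH] u r r' {}a {}c {}a' {}c'.
  by case: r r' => [|//] [|//] _ _; rewrite !cats0 => *; exact: fixed.
case: r r' => [//|x r] [//|x' r'] [rn] [rn'] o o' ac ac'.
have [c0 cS cE] := cl_sys.
have [so uo co] := o; have [so' uo' co'] := o'.
pose X z := [set v in rcons u z].
have cX : cl (X x).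
  by apply: cS co; apply/subsetP => v; rewrite !inE mem_cat mem_rcons !inE;
    case/orP => ->; rewrite ?orbT.
have cX' : cl (X x').
  by apply: cS co'; apply/subsetP => v; rewrite !inE mem_cat mem_rcons !inE;
    case/orP => ->; rewrite ?orbT.
have szu : (size u + n.+1 = m)%N by rewrite -so size_cat /= rn.
have cardX z : (#|X z| <= (size u).+1)%N.
  by rewrite -(size_rcons u z) cardsE card_size.
pose P W := cl (X x :|: W) && cl (X x' :|: W).
(* The bound [b + b] counts points that are bad for either prefix; avoiding [X x] and [X x'] keeps
   both tuples free of repetitions. *)
have [||||W [_ WL Wn /andP[PW PW']]] :=
    @greedy_extension V P (~: (X x :|: X x')) set0 (b + b) n.
- move=> Y _ Yn /andP[cY cY'].
  apply: (@leq_trans (#|[set z | ~~ cl (z |: (X x :|: Y))]| +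
                      #|[set z | ~~ cl (z |: (X x' :|: Y))]|)); last first.
    by apply: leq_add; apply: cE => //;
      apply: leq_ltn_trans (leq_card_setU _ _) _;
      [move: (cardX x)|move: (cardX x')]; move: Yn szu; clear; lia.
  apply: leq_trans (leq_card_setU _ _); apply: subset_leq_card.
  by apply/subsetP => z; rewrite !inE negb_and /P ![X _ :|: (z |: _)]setUCA.
- by rewrite /P !setU0 cX.
- by rewrite cards0.
- rewrite cardsCs setCK.
  have : (#|X x :|: X x'| <= (size u).+2)%N.
    rewrite (_ : _ :|: _ = [set v in x :: x' :: u]).
      by rewrite cardsE; apply: leq_trans (card_size _) _.
    apply/setP => v; rewrite !inE !mem_rcons !inE.
    by do !case: (_ == _); rewrite ?orbT ?orbb.
  by move: V_large szu; clear; lia.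
have Wnot z : z \in W -> z \notin X x :|: X x'.
  by move=> /(subsetP WL); rewrite set0U inE.
have ow z : (z = x \/ z = x') -> z \notin u -> uniq u -> cl (X z :|: W) ->
    ordered (u ++ z :: enum W).
  move=> zE zu uu cz; split; first by rewrite size_cat /= -cardE Wn.
    rewrite cat_uniq uu /= enum_uniq andbT negb_or zu /= mem_enum.
    apply/andP; split; last first.
      apply/negP => /Wnot; rewrite !inE !mem_rcons !inE.
      by case: zE => ->; rewrite eqxx ?orbT.
    apply/hasPn => v; rewrite mem_enum => /Wnot; rewrite !inE !mem_rcons !inE.
    by rewrite !negb_or => /andP[/andP[]].
  rewrite (_ : [set v in _] = X z :|: W)//; apply/setP => v.
  by rewrite !inE mem_cat mem_rcons !inE mem_enum orbA [(v \in u) || _]orbC.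
have [uu xu] : uniq u /\ x \notin u.
  by move: uo; rewrite cat_uniq /= negb_or => /and3P[-> /andP[->]].
have xu' : x' \notin u.
  by move: uo'; rewrite cat_uniq /= negb_or => /and3P[_ /andP[->]].
have o1 := ow x (or_introl erefl) xu uu PW.
have o2 := ow x' (or_intror erefl) xu' uu PW'.
have szW : size (enum W) = n by rewrite -cardE.
have [e [e1 e2]] := C_share (ordered_good o1) (ordered_good o2).
have /eqP/cards2P[p [q [_ eE]]] := C_edge (ordered_good o1) e1.
rewrite {}eE in e1 e2.
apply: (reach_trans _ (sz _ p q o1)) => //.
  by rewrite -!(cat_rcons x u); apply: IH => //; rewrite cat_rcons.
apply: (reach_trans _ (sz _ p q o2)) => //; first exact: change.
by rewrite -!(cat_rcons x' u); apply: IH => //; rewrite cat_rcons.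
Qed.

End OrderedTuples.

(** * Degrees *)

Section Degrees.

Variables (V : finType).
Implicit Types (G : {set {set V}}) (J S X : {set V}).

Definition degree G J : nat := #|[set X in G | J \subset X]|.

Definition uniform (r : nat) G := forall X, X \in G -> #|X| = r.

(** Both sides count pairs of an edge [X] containing [J] and a point [a] of [X] outside [J]. *)
Lemma degree_sum r G J : uniform r G ->
  ((r - #|J|) * degree G J = \sum_(a in ~: J) degree G (a |: J))%N.
Proof.
move=> Gr; rewrite mulnC /degree -sum_nat_const.
under [RHS]eq_bigr => a _ do rewrite -sum1_card.
transitivity (\sum_(X in [set X in G | J \subset X]) \sum_(a in X :\: J) 1)%N.
  apply: eq_bigr => X; rewrite inE => /andP[XG JX].
  by rewrite sum1_card cardsD (setIidPr JX) (Gr _ XG).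
rewrite (exchange_big_dep (mem (~: J))) /=; last first.
  by move=> X a _; rewrite !inE => /andP[].
apply: eq_bigr => a; rewrite inE => aJ; apply: eq_bigl => X.
by rewrite !inE aJ subUset sub1set -andbA; do !case: (_ \in _);
  rewrite ?andbT ?andbF.
Qed.

Lemma degree_le r G J : uniform r G ->
  (degree G J <= 'C(#|V| - #|J|, r - #|J|))%N.
Proof.
move=> Gr; have -> : (#|V| - #|J| = #|~: J|)%N by rewrite [RHS]cardsCs setCK.
rewrite -cards_draws /degree.
have inj : {in [set X in G | J \subset X] &, injective (fun X => X :\: J)}.
  move=> X Y; rewrite !inE => /andP[_ JX] /andP[_ JY] XY.
  by rewrite -(setID X J) -(setID Y J) XY (setIidPr JX) (setIidPr JY).
rewrite -(card_in_imset inj).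
apply/subset_leq_card/subsetP => _ /imsetP[X + ->].
rewrite inE => /andP[XG JX]; rewrite inE setDE subsetIr /=.
by rewrite -setDE cardsD (setIidPr JX) (Gr _ XG).
Qed.

Lemma clean_extensions_lower m b cl J : clean_system m b cl ->
  cl J -> (#|J| < m)%N -> (#|V| - #|J| - b <= #|[set a in ~: J | cl (a |:
    J)]|)%N.
Proof.
move=> [_ _ ext] cJ Jm.
have -> : (#|V| - #|J| = #|~: J|)%N by rewrite [RHS]cardsCs setCK.
rewrite leq_subLR.
apply: leq_trans (leq_add (ext J Jm cJ) (leqnn _)).
apply: leq_trans (leq_card_setU _ _); apply: subset_leq_card.
by apply/subsetP => a; rewrite !inE => ->; case: (cl _).
Qed.

(** Induction on [d - #|J|]: [degree_sum] averages over the one-point extensions of [J], of which a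
    proportion of at least [1 - beta] is clean, so each size below [d] costs a factor [1 - beta]. *)
Lemma degree_lower (R : realFieldType) (m b d r : nat) (cl : {set V} -> bool) G
    (x beta : R) :
  clean_system m b cl -> uniform r G -> (d <= m)%N -> (d <= r)%N ->
  0 <= x -> 0 <= beta <= 1 -> b%:R <= beta * (#|V| - d)%:R ->
  (forall S, cl S -> #|S| = d -> x * 'C(#|V| - d, r - d)%:R <= (degree G S)%:R)
    ->
  forall J, cl J -> (#|J| <= d)%N ->
  x * (1 - beta) ^+ (d - #|J|) * 'C(#|V| - #|J|, r - #|J|)%:R <= (degree G
    J)%:R.
Proof.
move=> cs Gr dm dr x0 /andP[b0 b1] bb low J.
have [n nE] : exists n, n = (d - #|J|)%N by eexists.
elim: n J nE => [|n IH] J nE cJ Jd.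
  have Jd' : #|J| = d by lia.
  by rewrite -nE expr0 mulr1 Jd'; exact: low.
have Jltd : (#|J| < d)%N by lia.
set j := #|J| in nE Jd Jltd *.
have c0 : 0 < (r - j)%:R :> R by rewrite ltr0n; lia.
rewrite -(ler_pM2l c0) -[leRHS]natrM (degree_sum _ Gr) -nE.
have N0 : (#|V| - j - b <= #|[set a in ~: J | cl (a |: J)]|)%N.
  by apply: clean_extensions_lower cs cJ _; exact: leq_trans dm.
set y := x * (1 - beta) ^+ n * 'C(#|V| - j.+1, r - j.+1)%:R.
have y0 : 0 <= y.
  by rewrite /y mulr_ge0// mulr_ge0// exprn_ge0// subr_ge0.
apply: (@le_trans _ _ ((#|V| - j - b)%:R * y)).
  rewrite (_ : _ * (_ * _) = (1 - beta) * (#|V| - j)%:R * y).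
    apply: ler_wpM2r => //; rewrite mulrBl mul1r.
    have: beta * (#|V| - d)%:R <= beta * (#|V| - j)%:R.
      by apply: ler_wpM2l => //; rewrite ler_nat; lia.
    (* Natural subtraction truncates when [b] exceeds [#|V| - j]; the left side is then
       nonpositive. *)
    case: (leqP b (#|V| - j)) => h; first by rewrite (natrB _ h); move: bb; lra.
    have : (#|V| - j)%:R <= b%:R :> R by rewrite ler_nat ltnW.
    have : 0 <= (#|V| - j - b)%:R :> R by [].
    move=> *; lra.
  have jr : (j < r)%N by exact: leq_trans dr.
  rewrite -mulrA.
  have -> : (#|V| - j)%:R * y =
      x * (1 - beta) ^+ n * ((#|V| - j) * 'C((#|V| - j).-1, r - j.+1))%:R.
    by rewrite natrM /y subnS; ring.
  by rewrite mul_bin_diag -subSn// subSS natrM exprS; ring.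
rewrite natr_sum (bigID (fun a => cl (a |: J))) /=.
rewrite -[leLHS]addr0 lerD ?sumr_ge0//.
apply: (@le_trans _ _ (\sum_(a in ~: J | cl (a |: J)) y)); last first.
  apply: ler_sum => a /andP[]; rewrite inE => aJ ca.
  have cardaJ : #|a |: J| = j.+1 by rewrite cardsU1 aJ.
  have := IH (a |: J); rewrite cardaJ => /(_ _ ca Jltd).
  have -> : (d - j.+1 = n)%N by lia.
  exact.
rewrite sumr_const -[leRHS]mulr_natl ler_wpM2r// ler_nat.
apply: leq_trans N0 _; apply: subset_leq_card.
by apply/subsetP => a; rewrite inE.
Qed.

End Degrees.

(** * Robust matchability *)

(** The points of smallest weight are chosen greedily; [tau] serves as the shift in [dual_bound]. *)
Lemma low_set (R : realFieldType) (V : finType) (y : V -> R) (m : nat) :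
  (0 < #|V|)%N -> (m <= #|V|)%N ->
  exists (L : {set V}) (tau : R), [/\ #|L| = m,
    forall v, v \in L -> y v <= tau & forall v, v \notin L -> tau <= y v].
Proof.
move=> V0; elim: m => [_|m IH mV].
  have /card_gt0P[v0 _] := V0.
  case: (@arg_minP _ _ _ v0 predT y isT) => v _ vmin.
  by exists set0, (y v); split=> [|w|w _]; rewrite ?cards0 ?inE ?vmin.
have [L [tau [Lm Ltau tauL]]] := IH (ltnW mV).
have [v0 v0L] : exists v, v \notin L.
  have : (0 < #|~: L|)%N by rewrite cardsCs setCK Lm subn_gt0.
  by case/card_gt0P => v; rewrite inE; exists v.
case: (@arg_minP _ _ _ v0 (fun v => v \notin L) y v0L) => v vL vmin.
exists (v |: L), (y v); split.
- by rewrite cardsU1 vL Lm.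
- move=> w /setU1P[->//|wL]; exact: le_trans (Ltau _ wL) (tauL _ vL).
- by move=> w; rewrite in_setU1 negb_or => /andP[_]; exact: vmin.
Qed.

Section Matching.

Variables (R : realType) (k t b : nat) (V : finType).
Variables (H : {set cset t V}) (B : {set 'I_t}) (cl : 'I_t -> {set V} -> bool).
Variables (C : cset t V -> {set {set V}}) (gamma kappa : R).
Let N : R := kappa * #|V|%:R.
Hypothesis k3 : (3 <= k)%N.
Hypothesis V0 : (0 < #|V|)%N.
Hypothesis cl_sys : forall i, clean_system (k - 2) b (cl i).
Hypothesis cl_point : forall v, (#|[set i | ~~ cl i [set v]]| <= b)%N.
Let good i (S : {set V}) := cl i S /\ #|S| = (k - 2)%N.
Hypothesis H_unif : is_1kgraph k H.
Hypothesis C_H : forall i S e, good i S -> e \in C (i, S) ->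
  [disjoint S & e] /\ (i, S :|: e) \in H.
Hypothesis C_match : forall i S, good i S -> exists2 w : {set V} -> R,
  fractional_matching (C (i, S)) w & \sum_(e in C (i, S)) w e = N.
Hypothesis gamma01 : 0 <= gamma <= 1.
Hypothesis kappa_large : k%:R^-1 <= (1 - gamma) * kappa.
Hypothesis b_small : (b + (b + k))%:R <= (1 - gamma) * #|V|%:R / k%:R.

(* Linear programming duality turns robust matchability into this inequality.
   After a shift making a set [L] of [b + k] points nonpositive and all other
   points nonnegative, a clean set inside [L] (together with one point) and a
   large matching of its vicinity bound the positive part of [yv] from below. *)
Lemma dual_bound (bc : 'I_t -> R) (bv : V -> R) (yc : 'I_t -> R) (yv : V -> R) :
  (forall c, c \in B -> 1 - gamma <= bc c <= 1) ->
  (forall v, 1 - gamma <= bv v <= 1) ->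
  k%:R * (\sum_(c in B) bc c) = \sum_v bv v ->
  (forall e, e \in H -> e.1 \in B -> 0 <= yc e.1 + \sum_(v in e.2) yv v) ->
  0 <= \sum_(c in B) bc c * yc c + \sum_v bv v * yv v.
Proof.
move=> bcP bvP bcv dual.
have [g0 g1] := andP gamma01.
have k0 : 0 < k%:R :> R by rewrite ltr0n; lia.
have n0 : 0 < #|V|%:R :> R by rewrite ltr0n.
have kap0 : 0 < kappa.
  rewrite ltNge; apply/negP => kap; have : 0 < (1 - gamma) * kappa.
    by apply: lt_le_trans kappa_large; rewrite invr_gt0.
  by rewrite ltNge mulr_ge0_le0// subr_ge0.
have N0 : 0 < N by rewrite mulr_gt0.
have bkV : (b + k <= #|V|)%N.
  rewrite -(ler_nat R); apply: (@le_trans _ _ (b + (b + k))%:R).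
    by rewrite ler_nat leq_addl.
  apply: le_trans b_small _; rewrite ler_pdivrMr//.
  apply: (@le_trans _ _ (1 * #|V|%:R)); first by rewrite ler_pM2r//; lra.
  by rewrite mul1r; apply: ler_peMr; [exact: ltW|rewrite ler1n; lia].
have [L [tau [Lbk Ltau tauL]]] := low_set yv V0 bkV.
(* The shift changes neither the edge inequalities, as an edge has one color and [k] points, nor the
   objective, by [bcv]. *)
pose xv v := yv v - tau; pose xc c := yc c + k%:R * tau.
have -> : \sum_(c in B) bc c * yc c + \sum_v bv v * yv v =
          \sum_(c in B) bc c * xc c + \sum_v bv v * xv v.
  have -> : \sum_(c in B) bc c * xc c =
            \sum_(c in B) bc c * yc c + k%:R * (\sum_(c in B) bc c) * tau.
    rewrite -mulrA mulr_suml mulr_sumr -big_split /=.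
    by apply: eq_bigr => c _; rewrite /xc; ring.
  have -> : \sum_v bv v * xv v = \sum_v bv v * yv v - (\sum_v bv v) * tau.
    by rewrite mulr_suml -sumrB; apply: eq_bigr => v _; rewrite /xv; ring.
  by rewrite bcv; ring.
have dualx e : e \in H -> e.1 \in B -> 0 <= xc e.1 + \sum_(v in e.2) xv v.
  move=> eH eB; have := dual e eH eB.
  rewrite /xv sumrB sumr_const (H_unif eH) -mulr_natl /xc.
  by congr (_ <= _); ring.
have Lx v : v \in L -> xv v <= 0 by move=> /Ltau; rewrite subr_le0.
have Lx' v : v \notin L -> 0 <= xv v by move=> /tauL; rewrite subr_ge0.
pose p v := Num.max (xv v) 0.
have p0 v : 0 <= p v by rewrite le_max lexx orbT.
have xp v : xv v <= p v by rewrite le_max lexx.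
set P := \sum_v p v.
(* Extend [X] inside [L] to a clean set [S], which only adds nonpositive weights. Each edge of the
   vicinity of [S] then has positive part at least [- xc c - \sum_(v in X) xv v]; averaging with the
   matching, of total weight [N] and load at most 1 per point, gives the claim. *)
have key c X : c \in B -> cl c X -> (#|X| <= k - 2)%N ->
    N * (- xc c - \sum_(v in X) xv v) <= P.
  move=> cB cX Xk.
  have [c0 cS cE] := cl_sys c.
  have [||//||S [XS SL Sk cSS]] := @greedy_extension V (cl c) L X b (k - 2).
  - by move=> Y _; exact: cE.
  - exact: cX.
  - by rewrite Lbk leq_add2l leq_subr.
  have gS : good c S by [].
  have [w [w01 wv] wN] := C_match gS.
  have Sx : \sum_(v in S) xv v <= \sum_(v in X) xv v.
    rewrite (big_setID X) /= (setIidPr XS) -[leRHS]addr0 lerD2l.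
    apply: sumr_le0 => v /setDP[/(subsetP SL)/setUP[->//|vL] _]; exact: Lx.
  have pe e : e \in C (c, S) -> - xc c - \sum_(v in X) xv v <= \sum_(v in e) p
    v.
    move=> eC; have [dSe SeH] := C_H gS eC.
    have := dualx _ SeH cB; rewrite /= (big_setID S) /= (setIidPr (subsetUl S
      e)).
    rewrite setDUl setDv set0U (setDidPl _); last by rewrite disjoint_sym.
    have : \sum_(v in e) xv v <= \sum_(v in e) p v by apply: ler_sum => v _.
    move: Sx; lra.
  rewrite -wN mulr_suml.
  apply: (@le_trans _ _ (\sum_(e in C (c, S)) w e * \sum_(v in e) p v)).
    apply: ler_sum => e eC; apply: ler_wpM2l (pe e eC).
    by have /andP[] := w01 e eC.
  under eq_bigr => e _ do rewrite mulr_sumr.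
  rewrite (exchange_big_dep predT)//=; apply: ler_sum => v _.
  rewrite -mulr_suml -[leRHS]mul1r; apply: ler_wpM2r => //.
(* [M] is minus the least weight, truncated at 0, and [v1] attains the minimum. Putting [v1] into
   the clean set gains [M] at every color where [v1] is clean. *)
have [M [M0 MP] [v1 keyM]] : exists2 M, 0 <= M /\ (forall v, - M <= xv v) &
    exists v1, forall c, c \in B -> cl c [set v1] -> N * (M - xc c) <= P.
  have /card_gt0P[v0 _] := V0.
  case: (@arg_minP _ _ _ v0 predT xv isT) => v1 _ v1min.
  exists (Num.max (- xv v1) 0).
    split=> [|v]; first by rewrite le_max lexx orbT.
    have := v1min v isT; have : - xv v1 <= Num.max (- xv v1) 0 by rewrite
      le_max lexx.
    lra.
  exists v1 => c cB cv1.
  have [x0|x0] := leP (- xv v1) 0.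
    have [c0 _ _] := cl_sys c.
    by have := key c set0 cB c0; rewrite cards0 big_set0 subr0 add0r; exact.
  have := key c _ cB cv1; rewrite cards1 big_set1 [- xv v1 - _]addrC; apply.
  by rewrite subn_gt0.
pose Q := P / N.
have PQ : P = N * Q by rewrite /Q mulrCA divff ?mulr1// gt_eqF.
have Q0 : 0 <= Q by apply: divr_ge0; [exact: sumr_ge0|exact: ltW].
have xcQ c : c \in B -> - Q <= xc c.
  move=> cB; have [c0 _ _] := cl_sys c.
  have := key c set0 cB c0; rewrite cards0 big_set0 subr0 PQ => /(_ isT).
  by rewrite ler_pM2l// lerNl.
have xcM c : c \in B -> cl c [set v1] -> M - Q <= xc c.
  by move=> cB cv1; have := keyM c cB cv1; rewrite PQ ler_pM2l//; lra.
set Z := \sum_(c in B) bc c in bcv.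
have bcpos c : c \in B -> 0 <= bc c.
  by move=> /bcP/andP[+ _]; apply: le_trans; rewrite subr_ge0.
(* The colors at which [v1] is unclean have total demand at most [b], so the better bound [M - Q]
   covers demand at least [Z - b]. *)
have low_c : - Q * Z + M * (Z - b%:R) <= \sum_(c in B) bc c * xc c.
  have Zb : Z - b%:R <= \sum_(c in B | cl c [set v1]) bc c.
    rewrite lerBlDr /Z (bigID (fun c => cl c [set v1])) /= lerD2l.
    apply: (@le_trans _ _ (\sum_(c in B | ~~ cl c [set v1]) 1)).
      by apply: ler_sum => c /andP[/bcP/andP[]].
    rewrite sumr_const ler_nat; apply: leq_trans (cl_point v1).
    by apply: subset_leq_card; apply/subsetP => c; rewrite !inE => /andP[].
  apply: (@le_trans _ _ (- Q * Z + M * \sum_(c in B | cl c [set v1]) bc c)).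
    by rewrite lerD2l ler_wpM2l.
  rewrite big_mkcondr /= !mulr_sumr -big_split /=; apply: ler_sum => c cB.
  case: ifP => ccl.
    by have := ler_wpM2l (bcpos c cB) (xcM c cB ccl); lra.
  by have := ler_wpM2l (bcpos c cB) (xcQ c cB); lra.
(* Only the [b + k] points of [L] can have negative weight, and each contributes at least [- M]. *)
have low_v : (1 - gamma) * P - (b + k)%:R * M <= \sum_v bv v * xv v.
  have -> : (b + k)%:R * M = \sum_v (if v \in L then M else 0).
    by rewrite -big_mkcond /= sumr_const Lbk mulr_natl.
  rewrite mulr_sumr -sumrB; apply: ler_sum => v _.
  have /andP[bl bu] := bvP v; have bv0 : 0 <= bv v by apply: le_trans bl;
    rewrite subr_ge0.
  case: ifPn => vL.
    have -> : p v = 0 by apply/max_idPr; exact: Lx.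
    have := MP v; have := Lx v vL.
    have : bv v * xv v >= xv v by rewrite -[leLHS]mul1r ler_wnM2r// Lx.
    lra.
  have -> : p v = xv v by apply/max_idPl; exact: Lx'.
  by rewrite subr0 ler_wpM2r// Lx'.
have Zlow : (1 - gamma) * #|V|%:R <= k%:R * Z.
  rewrite bcv mulr_natr -sumr_const; apply: ler_sum => v _.
  by have /andP[] := bvP v.
have Zup : k%:R * Z <= #|V|%:R.
  rewrite bcv -sumr_const.
  by apply: ler_sum => v _; have /andP[] := bvP v.
(* Here the matching density enters: [Z] is at most [#|V| / k], while [(1 - gamma) * kappa] is at
   least [1 / k]. *)
have QZ : Q * Z <= (1 - gamma) * P.
  rewrite PQ /N; apply: (@le_trans _ _ (k%:R^-1 * (#|V|%:R * Q))).
    rewrite ler_pdivlMl// mulrCA [leLHS]mulrC; apply: ler_wpM2r => //.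
  rewrite (_ : (1 - gamma) * (_ * _ * _) = (1 - gamma) * kappa * (#|V|%:R *
    Q)); last by ring.
  by apply: ler_wpM2r => //; rewrite mulr_ge0.
(* By [Zlow] and [b_small], the demand [Z] exceeds both losses [b] and [b + k] together. *)
have MZ : 0 <= M * (Z - b%:R - (b + k)%:R).
  apply: mulr_ge0 => //; rewrite -addrA -opprD -natrD subr_ge0.
  by apply: le_trans b_small _; rewrite ler_pdivrMr// [leRHS]mulrC.
move: low_c low_v QZ MZ; lra.
Qed.

(** Farkas' lemma is applied to the incidence vectors of the edges and the demand vector [g]; its
    hypothesis is [dual_bound] with the signs reversed. It yields nonnegative weights, and the color
    equations bound each of them by 1. *)
Lemma induced_robustly_matchable : robustly_matchable k (induced H B) B gamma.
Proof.
move=> bc bv bcP bvP bcv.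
have k0 : 0 < k%:R :> R by rewrite ltr0n; lia.
pose a (e : cset t V) (d : 'I_t + V) : R :=
  match d with inl c => (c == e.1)%:R | inr v => (v \in e.2)%:R end.
pose g (d : 'I_t + V) : R :=
  match d with inl c => if c \in B then bc c / k%:R else 0
             | inr v => bv v / k%:R end.
have [x ax|w w0 gw] := farkas (a := a) (g := g) (enum_uniq (induced H B)).
  rewrite big_sumType /=.
  have := @dual_bound bc bv (fun c => - x (inl c)) (fun v => - x (inr v)) bcP
    bvP bcv.
  have -> : \sum_(c in B) bc c * - x (inl c) + \sum_v bv v * - x (inr v) =
     - (k%:R * (\sum_c (if c \in B then bc c / k%:R else 0) * x (inl c) +
         \sum_v bv v / k%:R * x (inr v))).
    rewrite mulrDr opprD !mulr_sumr -!sumrN (big_mkcond (mem B)) /=.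
    congr (_ + _); apply: eq_bigr => i _.
      by case: ifP => _; [field; rewrite gt_eqF|rewrite mul0r mulr0 oppr0].
    by field; rewrite gt_eqF.
  rewrite oppr_ge0 pmulr_rle0//; apply => e eH eB.
  have := ax e; rewrite mem_enum inE eH eB => /(_ isT).
  rewrite big_sumType /= (bigD1 e.1) //= eqxx mul1r big1 ?addr0; last first.
    by move=> c /negbTE->; rewrite mul0r.
  rewrite (_ : \sum_v _ = \sum_(v in e.2) x (inr v)).
    by rewrite sumrN -opprD oppr_ge0.
  rewrite [RHS]big_mkcond; apply: eq_bigr => v _.
  by case: (v \in e.2); rewrite ?mul1r ?mul0r.
have wc c : c \in B -> \sum_(e in induced H B | e.1 == c) w e = bc c / k%:R.
  move=> cB; have := gw (inl c); rewrite /= cB => ->.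
  rewrite big_enum big_mkcondr; apply: eq_bigr => e _ /=.
  by rewrite [c == _]eq_sym; case: ifP; rewrite ?mulr1 ?mulr0.
exists w; split=> // [e eH|v].
  rewrite w0 /=; have eB : e.1 \in B by move: eH; rewrite inE => /andP[].
  apply: (@le_trans _ _ (bc e.1 / k%:R)).
    rewrite -wc// (bigD1 e) ?eqxx ?andbT//= lerDl sumr_ge0//.
  rewrite ler_pdivrMr// mul1r; have /andP[_ /le_trans] := bcP _ eB; apply.
  by rewrite ler1n; lia.
have := gw (inr v) => /= ->.
rewrite big_enum big_mkcondr; apply: eq_bigr => e _ /=.
by case: ifP; rewrite ?mulr1 ?mulr0.
Qed.

End Matching.

(** * Vicinities in clean graphs *)

Section ColorSlices.

Variables (k t : nat) (V : finType).
Implicit Types (E : {set cset t V}) (i : 'I_t) (s : cset t V).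

Definition color_slice E i : {set {set V}} := [set X | (i, X) \in E].

Lemma deg_slice E s : deg E s = degree (color_slice E s.1) s.2.
Proof.
rewrite /deg /degree -(card_imset _ (f := fun X : {set V} => (s.1, X)));
  last first.
  by move=> X Y [].
apply: eq_card => -[i X]; rewrite inE /sub_cset /=; apply/idP/imsetP.
  move=> /and3P[XE /eqP si sX]; exists X; last by rewrite -si.
  by rewrite !inE -si XE.
by case=> Y; rewrite !inE => /andP[YE sY] [-> ->]; rewrite YE eqxx.
Qed.

Lemma mem_at_color E i e : (e \in at_color E i) = (e \in E) && (e.1 == i).
Proof. by rewrite in_set in_set1. Qed.

Lemma slice_at_color E i : color_slice (at_color E i) i = color_slice E i.
Proof. by apply/setP => X; rewrite !inE /= eqxx andbT. Qed.

Lemma slice_sub_at_color E i X :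
  X \in color_slice E i -> (i, X) \in at_color E i.
Proof. by rewrite in_set mem_at_color eqxx andbT. Qed.

Lemma slice_uniform E i : is_1kgraph k E -> uniform k (color_slice E i).
Proof. by move=> Ek X; rewrite inE => /Ek. Qed.

Lemma shadow_slice j E s : (s \in shadow j E) =
  (#|s.2| == j) && [exists X in color_slice E s.1, s.2 \subset X].
Proof.
rewrite inE; congr andb; apply/exists_inP/exists_inP => -[].
  move=> [i X] XE /andP[/= /eqP si sX]; exists X => //.
  by rewrite inE -si.
by move=> X XE sX; exists (s.1, X); [rewrite inE in XE|rewrite /sub_cset eqxx].
Qed.

Lemma shadow_at_color j E i s :
  (s \in shadow j (at_color E i)) = (s.1 == i) && (s \in shadow j E).
Proof.
rewrite !shadow_slice; case: (s.1 =P i) => [<-|si];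
  first by rewrite slice_at_color.
apply/negbTE; rewrite negb_and; apply/orP; right; apply/exists_inP => -[X].
by rewrite !inE => /andP[_ /eqP/si].
Qed.

(** Disjointness is not part of [link]; it follows from uniformity, as an overlap would leave fewer
    than [k] points in the union. *)
Lemma mem_link E s X : is_1kgraph k E -> (#|s.2| <= k)%N -> X \in link k E s ->
  [/\ #|X| = (k - #|s.2|)%N, [disjoint s.2 & X] & (s.1, s.2 :|: X) \in E].
Proof.
move=> Ek sk; rewrite inE => /andP[/eqP Xk XE].
split => //; last by rewrite setUC.
have := Ek _ XE; rewrite /= cardsU Xk subnK// => I0.
rewrite -setI_eq0 setIC -cards_eq0; have : (#|X :&: s.2| <= k)%N.
  by apply: leq_trans sk; apply: subset_leq_card; exact: subsetIr.
by move: I0; clear; lia.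
Qed.

(** Repeating one color turns a tight walk into a sequentially walk; its first and last edges are
    recorded for use in tight connectivity. *)
Lemma seq_walk_const (G : {set {set V}}) E i (s : seq V) : (k <= size s)%N ->
  tight_walk k G s -> (forall X, X \in G -> (i, X) \in E) ->
  seq_walk k E s (nseq (size s - k).+1 i) /\
  exists2 p, walk_edges k s (nseq (size s - k).+1 i) = (i, window k 0 s) :: p &
    last (i, window k 0 s) p = (i, window k (size s - k) s).
Proof.
move=> ks wG GE.
have E1 : walk_edges k s (nseq (size s - k).+1 i) =
    [seq (i, window k j s) | j <- iota 0 (size s - k).+1].
  rewrite /walk_edges /windows -[nseq _ _](_ : [seq i | _ <- iota 0 (size s -
    k).+1] = _).
    by rewrite zip_map.
  by rewrite -[in RHS](size_iota 0 (size s - k).+1);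
    elim: (iota _ _) => //= ? l ->.
split; first split => //; first by rewrite size_nseq.
  move=> e; rewrite E1 => /mapP[j];
    rewrite mem_iota add0n ltnS => /andP[_ jk] ->.
  by apply: GE; apply: wG; rewrite -(subnK ks) leq_add2r.
rewrite E1 /=; eexists; first by [].
rewrite (last_map (fun j => (i, window k j s)) _ 0%N).
have lastE m r : last m (iota m.+1 r) = (m + r)%N.
  by elim: r m => [|r IH] m /=; rewrite ?addn0// IH addSnnS.
by rewrite lastE add0n.
Qed.

End ColorSlices.

(** * Graphs whose edges have clean point sets *)

Section CleanGraphs.

Variables (R : realType) (k n b : nat) (V : finType) (beta x : R).
Variables (E : {set cset n V}) (cl : 'I_n -> {set V} -> bool).
Hypothesis k3 : (3 <= k)%N.
Hypothesis V_card : #|V| = n.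
Hypothesis kn : (k <= n)%N.
Hypothesis cl_sys : forall i, clean_system (k - 2) b (cl i).
Hypothesis E_unif : is_1kgraph k E.
Hypothesis E_clean : forall e, e \in E -> cl e.1 e.2.
Hypothesis x0 : 0 < x.
Hypothesis E_deg : forall i S, cl i S -> #|S| = (k - 2)%N ->
  x * 'C(n - (k - 2), 2)%:R <= (deg E (i, S))%:R.
Hypothesis beta01 : 0 <= beta <= 1.
Hypothesis b_small : b%:R <= beta * (n - (k - 2))%:R.
Hypothesis b_lt : (b + (k - 2) <= n)%N.

(** Subsets of edges are clean by heredity. Conversely, a clean set extends greedily to a clean
    [(k - 2)]-set, which has positive degree by [E_deg]. *)
Lemma shadow_clean j s : (j <= k - 2)%N ->
  (s \in shadow j E) = (#|s.2| == j) && cl s.1 s.2.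
Proof.
move=> jk; rewrite shadow_slice; case: eqP => //= sj.
have [c0 cS cE] := cl_sys s.1.
apply/exists_inP/idP => [[X]|cs].
  by rewrite inE => /E_clean /= cX sX; exact: cS cX.
have [||||S [sS _ Sk cSS]] := @greedy_extension V (cl s.1) setT s.2 b (k - 2).
- by move=> Y _; exact: cE.
- exact: cs.
- by rewrite sj.
- by rewrite cardsT V_card.
have : 0 < (deg E (s.1, S))%:R :> R.
  apply: lt_le_trans (E_deg cSS Sk); rewrite mulr_gt0// ltr0n bin_gt0.
  by move: kn k3; clear; lia.
rewrite ltr0n deg_slice => /card_gt0P[X]; rewrite inE /= => /andP[XE SX].
by exists X => //; exact: subset_trans SX.
Qed.

Let b_small' d : (d <= k - 2)%N -> b%:R <= beta * (#|V| - d)%:R.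
Proof.
move=> dk; apply: le_trans b_small _; have /andP[b0 _] := beta01.
by rewrite V_card; apply: ler_wpM2l => //; rewrite ler_nat leq_sub2l.
Qed.

Lemma expr_beta d : (d <= k - 2)%N -> (1 - beta) ^+ (k - 2) <= (1 - beta) ^+ d.
Proof.
have /andP[b0 b1] := beta01.
by move=> dk; apply: ler_wiXn2l => //; rewrite ?subr_ge0// gerBl.
Qed.

Lemma clean_degree_lower (G : {set {set V}}) i (y : R) J :
  uniform k G -> 0 <= y ->
  (forall S, cl i S -> #|S| = (k - 2)%N -> y * 'C(n - (k - 2), 2)%:R <= (degree
    G S)%:R) ->
  cl i J -> (#|J| <= k - 2)%N ->
  y * (1 - beta) ^+ (k - 2) <= (degree G J)%:R / 'C(n - #|J|, k - #|J|)%:R.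
Proof.
move=> Gk y0 low cJ Jk; have /andP[b0 b1] := beta01.
rewrite ler_pdivlMr; last by rewrite ltr0n bin_gt0 leq_sub2r.
have k2 : (k - (k - 2) = 2)%N by move: k3; clear; lia.
have := degree_lower (cl_sys i) Gk (leqnn _) (leq_subr _ _) y0 beta01
  (b_small' (leqnn _)) _ cJ Jk.
rewrite V_card k2 => /(_ low); apply: le_trans; apply: ler_wpM2r => //.
by apply: ler_wpM2l => //; apply: expr_beta; exact: leq_subr.
Qed.

Lemma clean_perturbed (alpha delta : R) : beta < alpha ->
  1 - (1 - beta) ^+ (k - 2) <= alpha ->
  delta <= x * (1 - beta) ^+ (k - 2) ->
  forall i, perturbed_min_reldeg_ge k [set i] (at_color E i) alpha delta.
Proof.
move=> ba pa dx i j /andP[j1 jk]; have /andP[b0 b1] := beta01.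
have [c0 cS cE] := cl_sys i.
have Eslice := slice_uniform (i := i) E_unif.
split.
- move=> s; rewrite shadow_at_color shadow_clean// => /and3P[/eqP si /eqP sj
    cs].
  apply: le_trans dx _; rewrite /reldeg deg_slice si slice_at_color V_card.
  apply: (clean_degree_lower (i := i)) => //; rewrite ?ltW -?si ?sj//.
  by move=> S cS' Sk; have := E_deg cS' Sk; rewrite deg_slice.
(* In the [j]-graph of clean [j]-sets each of them has degree 1, so [degree_lower] at the empty set
   bounds their number from below. *)
- pose G := [set J : {set V} | (#|J| == j) && cl i J].
  have Gj : uniform j G by move=> J; rewrite inE => /andP[/eqP].
  have lowG : 'C(n, j)%:R - #|G|%:R <= alpha * 'C(n, j)%:R.
    have := degree_lower (cl_sys i) Gj jk (leqnn j) ler01 beta01 (b_small' jk)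
      _ c0.
    rewrite cards0 leq0n !subn0 !mul1r V_card => low.
    have : (1 - beta) ^+ j * 'C(n, j)%:R <= #|G|%:R.
      apply: le_trans (low _ isT) _ => [S cSS Sj|]; last first.
        by rewrite ler_nat; apply: subset_leq_card; apply/subsetP=> X;
          rewrite inE => /andP[].
      rewrite subnn bin0 ler1n card_gt0; apply/set0Pn; exists S.
      by rewrite !inE Sj eqxx cSS subxx.
    have : (1 - alpha) * 'C(n, j)%:R <= (1 - beta) ^+ j * 'C(n, j)%:R.
      by apply: ler_wpM2r => //; have := expr_beta jk; lra.
    by lra.
  rewrite cards1 mul1n V_card ler_pdivrMr; last by rewrite ltr0n bin_gt0;
    move: j1 jk kn k3; clear; lia.
  apply: le_trans lowG.
  have -> : 'C(n, j) = #|[set J : {set V} | #|J| == j]| by rewrite card_draws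
    V_card.
  rewrite lerBrDr -natrD ler_nat.
  rewrite -(cardsID G [set J : {set V} | #|J| == j]) addnC.
  apply: leq_add; first by apply: subset_leq_card; apply/subsetP => J;
    rewrite !inE => /andP[-> ->].
  rewrite -(card_imset _ (f := fun X : {set V} => (i, X)));
    last by move=> X Y [].
  apply: subset_leq_card; apply/subsetP => -[i' J].
  rewrite in_setD shadow_at_color shadow_clean// !inE /= => /and3P[nc /eqP iE
    Jj].
  rewrite iE eqxx Jj /= in nc *; apply/imsetP; exists J => //.
  by rewrite !inE Jj andbT.
move=> s; rewrite shadow_at_color shadow_clean;
  last by rewrite (leq_trans (leq_pred j)).
move=> /and3P[/eqP si /eqP sj cs].
rewrite si in cs.
rewrite /reldeg /deg; have -> : (j - #|s.2| = 1)%N by rewrite sj;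
  move: j1 jk kn k3; clear; lia.
rewrite bin1 V_card ltr_pdivrMr; last by rewrite ltr0n sj; move: j1 jk kn k3;
  clear; lia.
(* A [j]-set outside the shadow that contains [s] is [s] plus one point making it unclean, so there
   are at most [b] of them. *)
apply: (@le_lt_trans _ _ b%:R).
  rewrite ler_nat; apply: leq_trans (cE s.2 _ cs); last by rewrite sj;
    move: j1 jk kn k3; clear; lia.
  apply: leq_trans (leq_imset_card (fun a => (i, a |: s.2)) _).
  apply: subset_leq_card; apply/subsetP => -[i' J].
  rewrite inE in_setD shadow_at_color shadow_clean// in_set /= in_set1.
  move=> /andP[/and3P[nc /eqP iE /eqP Jj] /andP[_ sJ]].
  rewrite iE eqxx Jj eqxx /= in nc *.
  have /eqP/cards1P[a aE] : #|J :\: s.2| = 1%N.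
    by rewrite cardsD (setIidPr sJ) Jj sj; move: j1 jk kn k3; clear; lia.
  have JE : J = a |: s.2 by rewrite -aE setUC -{1}(setIidPr sJ) setID.
  by apply/imsetP; exists a; rewrite ?inE -JE.
have n0 : 0 < (n - #|s.2|)%:R :> R by rewrite ltr0n sj; move: j1 jk kn k3;
  clear; lia.
apply: (@le_lt_trans _ _ (beta * (n - #|s.2|)%:R)); last by rewrite ltr_pM2r.
by rewrite sj -V_card; apply: b_small'; move: jk; clear; lia.
Qed.

(** * The framework built from a family of vicinities *)

Variables (C : cset n V -> {set {set V}}) (alpha gamma gamma' delta : R).
Hypothesis cl_point : forall v, (#|[set i | ~~ cl i [set v]]| <= b)%N.
Hypothesis k_dvd_n : (k %| n)%N.
Hypothesis C_link : vicinity_family k E C.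
Hypothesis C_family : rainbow_hamilton_family k E C gamma' delta.
Hypothesis n_large : (4 * b + 3 * k <= n)%N.
Hypothesis beta_alpha : beta <= alpha.
Hypothesis gamma_bounds : 0 <= gamma <= gamma' / 2 /\ gamma' <= 1.
Hypothesis b_match : (b + (b + k))%:R <= (1 - gamma) * n%:R / k%:R :> R.
Hypothesis delta0 : 0 < delta.
Hypothesis beta_gamma :
  (1 - (1 - beta) ^+ (k - 2)) * (1 + gamma') <= gamma' - gamma.

Definition vicinity_graph : {set cset n V} :=
  [set e in E | [exists S : {set V}, [&& S \subset e.2,
     (e.1, S) \in shadow (k - 2) E & e.2 :\: S \in C (e.1, S)]]].
Let H := vicinity_graph.

Let good i (S : {set V}) := cl i S /\ #|S| = (k - 2)%N.

Lemma good_shadow i S : good i S -> (i, S) \in shadow (k - 2) E.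
Proof. by move=> [cS Sk]; rewrite shadow_clean// Sk eqxx. Qed.

Lemma good_shadow_at i S : good i S -> (i, S) \in shadow (k - 2) (at_color E i).
Proof. by move=> gS; rewrite shadow_at_color eqxx good_shadow. Qed.

Lemma vicinity_edge i S e : good i S -> e \in C (i, S) ->
  [/\ #|e| = 2, [disjoint S & e] & (i, S :|: e) \in H].
Proof.
move=> gS eC; have sS := good_shadow gS.
have [] := mem_link E_unif _ (subsetP (C_link sS) _ eC).
  by rewrite gS.2 leq_subr.
rewrite /= gS.2 subKn; last by move: k3; clear; lia.
move=> e2 dSe XE; split => //; rewrite inE XE; apply/existsP; exists S => /=.
rewrite subsetUl sS setDUl setDv set0U (setDidPl _)//.
by rewrite disjoint_sym.
Qed.

Lemma vicinity_graph_unif : is_1kgraph k H.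
Proof. by move=> e; rewrite inE => /andP[/E_unif]. Qed.

Lemma vicinity_graphP i X : (i, X) \in H ->
  exists S e, [/\ good i S, e \in C (i, S) & X = S :|: e].
Proof.
rewrite inE => /andP[_ /existsP[S /= /and3P[SX sS eC]]].
exists S, (X :\: S); split => //.
  by move: sS; rewrite shadow_clean// => /andP[/eqP].
by rewrite -{1}(setIidPr SX) setID.
Qed.

Let m := (k - 2)%N.
Let km : k = m.+2. Proof. by rewrite /m; move: k3; clear; lia. Qed.

Let Hs i : {set {set V}} := color_slice H i.

Lemma vicinity_reach i s s' a c a' c' :
  size s = m -> size s' = m -> good i [set v in s] -> good i [set v in s'] ->
  [set a; c] \in C (i, [set v in s]) -> [set a'; c'] \in C (i, [set v in s']) ->
  reach k (Hs i) (s ++ [:: a; c]) (s' ++ [:: a'; c']).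
Proof.
move=> sm sm' gs gs' ac ac'; rewrite {1}km.
have [f1 f2 [f3 _] _ _] := C_family.
have us (r : seq V) : size r = m -> good i [set v in r] -> uniq r.
  by move=> rm [_]; rewrite cardsE -/m -rm => /card_uniqP.
apply: (reach_ordered (m := m) (b := b) (cl := cl i) (C := fun S => C (i, S)))
  => //.
- by rewrite V_card /m; move: n_large k3; clear; lia.
- by move=> S e gS /(vicinity_edge gS)[].
- by move=> S e gS /(vicinity_edge gS)[_ _ SeH]; rewrite in_set.
- by move=> S gS; apply: (f1 i); exact: good_shadow_at.
- by move=> S gS; apply: (f3 i); exact: good_shadow_at.
- by move=> S S' gS gS'; apply: (f2 i); exact: good_shadow_at.
- by split=> //; [exact: us|case: gs].
- by split=> //; [exact: us|case: gs'].
Qed.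

(** Both edges split into a clean set and an edge of its vicinity; [vicinity_reach] joins the
    corresponding orderings by a walk at color [i]. *)
Lemma vicinity_tightly_connected i : seq_tightly_connected k (at_color H i).
Proof.
move=> [i1 X] [i2 Y]; rewrite !mem_at_color => /andP[XH /eqP/= iE] /andP[YH
  /eqP/= iE2].
subst i1 i2.
have [S [e [gS eC XE]]] := vicinity_graphP XH.
have [T [f [gT fC YE]]] := vicinity_graphP YH.
have [/eqP/cards2P[a [c [_ eE]]] _ _] := vicinity_edge gS eC.
have [/eqP/cards2P[a' [c' [_ fE]]] _ _] := vicinity_edge gT fC.
have enumE (Z : {set V}) : [set v in enum Z] = Z.
  by apply/setP => v; rewrite inE mem_enum.
have sz (Z : {set V}) p q : good i Z -> size (enum Z ++ [:: p; q]) = k.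
  by move=> [_ Zk]; rewrite size_cat -cardE Zk km /m addn2 /=; move: k3; clear;
    lia.
have [||||||M [kM wM]] := @vicinity_reach i (enum S) (enum T) a c a' c'.
- by rewrite -cardE gS.2.
- by rewrite -cardE gT.2.
- by rewrite enumE.
- by rewrite enumE.
- by rewrite enumE -eE.
- by rewrite enumE -fE.
set s := _ ++ M ++ _ in wM.
have ks : (k <= size s)%N by rewrite size_cat sz// leq_addr.
have [sw [p wE lE]] := seq_walk_const (E := at_color H i) (i := i) ks wM
  (@slice_sub_at_color _ _ H i).
have set2E (Z : {set V}) p' q' : [set v in enum Z ++ [:: p';
  q']] = Z :|: [set p'; q'].
  by apply/setP => v; rewrite !inE mem_cat mem_enum !inE.
exists s, (nseq (size s - k).+1 i), p.
have XE' : window k 0 s = X.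
  rewrite window_catl ?sz// /window drop0 take_oversize ?sz// set2E -eE.
  by rewrite XE.
have YE' : window k (size s - k) s = Y.
  rewrite /s catA size_cat sz// addnK -[size _]addn0 window_catr.
  by rewrite /window drop0 take_oversize ?sz// set2E -fE YE.
by split => //; rewrite -XE' // lE YE'.
Qed.

Lemma vicinity_closed_walk i : exists (s : seq V) (cs : seq 'I_n),
  [/\ seq_walk k (at_color H i) s cs, closed_walk k s & size s = 1 %[mod k]].
Proof.
have [_ _ [_ arcs] _ _] := C_family.
have [vs [vsk [S1 e1 S2 e2]]] := arcs i.
have k0 : (0 < k)%N by rewrite km.
have {vsk} [v1 [t [a [c [r [tk vsE]]]]]] : exists v1 t a c r,
    size t = (k - 3)%N /\ vs = v1 :: t ++ [:: a; c; r].
  case: vs vsk {S1 e1 S2 e2} => // v1 vs [vsk].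
  exists v1; exists (take (k - 3) vs).
  have : size (drop (k - 3) vs) = 3 by rewrite size_drop vsk; move: k3; clear;
    lia.
  move: (cat_take_drop (k - 3) vs).
  case: (drop _ _) => [|a [|c [|r [|? ?]]]]//= vsE _.
  exists a, c, r; rewrite vsE; split => //.
  by rewrite size_take_min vsk; move: k3; clear; lia.
have k2E : (k - 2 = (k - 3).+1)%N by move: k3; clear; lia.
have k1E : (k - 1 = (k - 3).+2)%N by move: k3; clear; lia.
have kE : k = (k - 3).+3 by move: k3; clear; lia.
have win1 : window (k - 2) 0 vs = [set v in v1 :: t].
  by rewrite vsE /window drop0 k2E /= -tk take_size_cat.
have win2 : window 2 (k - 2) vs = [set a; c].
  rewrite vsE /window k2E /= -tk drop_size_cat//.
  by apply/setP => v; rewrite !inE.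
have win3 : window (k - 2) 1 vs = [set v in t ++ [:: a]].
  rewrite vsE /window /= drop0 -[[:: a; c; r]]/([:: a] ++ [:: c; r]) catA.
  by rewrite take_size_cat// size_cat tk k2E addn1.
have win4 : window 2 (k - 1) vs = [set c; r].
  rewrite vsE /window k1E /= -[[:: a; c; r]]/([:: a] ++ [:: c; r]) catA.
  rewrite drop_size_cat ?size_cat ?tk ?addn1//.
  by apply/setP => v; rewrite !inE.
rewrite win1 win2 in S1 e1; rewrite win3 win4 in S2 e2.
have gS1 : good i [set v in v1 :: t].
  by move: S1; rewrite shadow_at_color shadow_clean// => /and3P[_ /eqP].
have gS2 : good i [set v in t ++ [:: a]].
  by move: S2; rewrite shadow_at_color shadow_clean// => /and3P[_ /eqP].
have szt : size (v1 :: t) = m by rewrite /= tk /m k2E.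
have szta : size (t ++ [:: a]) = m by rewrite size_cat tk /m k2E addn1.
(* The arc moves from its first [k] points [xs] to its last [k] points [ys] in one step; [M] leads
   back from [ys] to [xs]. *)
have [M [kM wM]] := vicinity_reach szta szt gS2 gS1 e2 e1.
set xs := (v1 :: t) ++ _ in wM; set ys := (t ++ _) ++ _ in wM.
have szx : size xs = k by rewrite size_cat szt /= /m; move: k3; clear; lia.
have szy : size ys = k by rewrite size_cat szta /= /m; move: k3; clear; lia.
have vsy : vs = [:: v1] ++ ys by rewrite vsE /ys -!catA.
have vsx : vs = xs ++ [:: r] by rewrite vsE /xs /= -!catA.
have wvs : tight_walk k (Hs i) vs.
  have set2 (z : seq V) p q : [set v in z ++ [:: p;
    q]] = [set v in z] :|: [set p; q].
    by apply/setP => v; rewrite !inE mem_cat !inE.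
  have szvs : size vs = k.+1 by rewrite vsx size_cat szx addn1.
  case=> [|[|j]]; last by rewrite szvs; clear; lia.
    rewrite vsx window_catl ?szx// /window drop0 take_oversize ?szx// set2
      in_set.
    by have [] := vicinity_edge gS1 e1.
  rewrite vsy -[1%N]/(size [:: v1] + 0)%N window_catr /window drop0 => _.
  rewrite take_oversize ?szy// set2 in_set.
  by have [] := vicinity_edge gS2 e2.
clearbody xs ys.
have w1 : tight_walk k (Hs i) ((vs ++ M) ++ xs).
  rewrite (_ : _ ++ xs = [:: v1] ++ ys ++ (M ++ xs)); last by rewrite vsy !catA.
  apply: tight_walk_glue => //; first by rewrite szy leq_pred.
  by rewrite -vsy.
have w2 : tight_walk k (Hs i) (xs ++ [:: r] ++ M ++ xs).
  by rewrite catA -vsx catA.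
have w3 : tight_walk k (Hs i) ((vs ++ M) ++ xs ++ [:: r] ++ M ++ xs).
  by apply: tight_walk_glue => //; rewrite szx leq_pred.
(* One round [vs ++ M] has length 1 modulo [k], and closing the walk repeats [k - 1] points. Two
   rounds therefore give [2 + (k - 1)], that is 1 modulo [k]. *)
pose s := vs ++ M ++ vs ++ M ++ take k.-1 xs.
have w4 : tight_walk k (Hs i) s.
  have sE : (vs ++ M) ++ xs ++ [:: r] ++ M ++ xs = s ++ drop k.-1 xs.
    by rewrite /s -!catA cat_take_drop [xs ++ _]catA -vsx.
  move=> j js; rewrite -(window_catl (drop k.-1 xs) js) -sE; apply: w3.
  by rewrite sE size_cat; apply: leq_trans js (leq_addr _ _).
have szs : size s = ((size M + size M) + k * 3 + 1)%N.
  rewrite /s !size_cat size_take_min szx vsx size_cat szx /=; move: k3; clear;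
    lia.
have ks : (k <= size s)%N by rewrite szs; clear; lia.
have [sw _] := seq_walk_const (E := at_color H i) (i := i) ks w4
  (@slice_sub_at_color _ _ H i).
exists s, (nseq (size s - k).+1 i); split => //.
  have sT : size (take k.-1 xs) = k.-1 by rewrite size_takel// szx leq_pred.
  rewrite /closed_walk [RHS](_ : _ = take k.-1 xs); last first.
    by rewrite /s vsx -!catA takel_cat// szx leq_pred.
  rewrite /s !catA drop_size_cat// [size (_ ++ take _ _)]size_cat sT.
  by rewrite addnK.
apply/eqP; rewrite szs eqn_mod_dvd ?leq_addl// addnK.
by apply: dvdn_add; [exact: dvdn_add|exact: dvdn_mulr].
Qed.

Lemma vicinity_matchable (B : {set 'I_n}) :
  robustly_matchable k (induced H B) B gamma.
Proof.
have [_ _ _ f4 _] := C_family; have [/andP[g0 gg] g1] := gamma_bounds.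
have n0 : (0 < n)%N by move: kn k3; clear; lia.
have k0 : 0 < k%:R :> R by rewrite ltr0n km.
apply: (@induced_robustly_matchable R k n b V H B cl C gamma
  ((1 + k%:R^-1) * (k.+1%:R^-1 + gamma'))) => //.
- by rewrite V_card.
- exact: vicinity_graph_unif.
- by move=> i S e gS /(vicinity_edge gS)[].
- move=> i S gS; have [w wfm wd] := f4 i _ (good_shadow_at gS).
  exists w => //; rewrite -wd /matching_density mulfVK// V_card.
  by rewrite pnatr_eq0 -lt0n.
- by apply/andP; split=> //; move: gg g1; lra.
(* The density exceeds [1 / k] by [(1 + 1 / k) * gamma'], which covers the loss from the factor
   [1 - gamma] because [gamma <= gamma' / 2] and [gamma' <= 1]. *)
- have -> : (1 + k%:R^-1) * (k.+1%:R^-1 + gamma') =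
      k%:R^-1 + (1 + k%:R^-1) * gamma' :> R.
    by rewrite -natr1; field; rewrite natr1 gt_eqF//= gt_eqF.
  have ik : 0 < k%:R^-1 :> R by rewrite invr_gt0.
  have ik1 : k%:R^-1 <= 1 :> R by rewrite invf_le1// ler1n km.
  have g'0 : 0 <= gamma' by move: g0 gg; lra.
  have : k%:R^-1 + (1 + k%:R^-1) * gamma' <= 1 + (1 + k%:R^-1).
    by rewrite lerD// ler_piMr//; move: ik; lra.
  set q := k%:R^-1 in ik ik1 *.
  move=> h.
  have h1 : gamma * (q + (1 + q) * gamma') <= gamma' / 2 * (1 + (1 + q)).
    apply: ler_pM => //; apply: addr_ge0; first exact: ltW.
    by apply: mulr_ge0 => //; apply: addr_ge0 => //; exact: ltW.
  have h2 : 0 <= q * gamma' by apply: mulr_ge0; [exact: ltW|].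
  move: h1 h2; lra.
- by rewrite V_card.
Qed.

(** All but at most [b] points are clean at [i]. For a clean point, averaging over clean sets
    transfers the edge density of the vicinities to [H], and [beta_gamma] pays for the loss. *)
Lemma vicinity_point_degrees i : (1 - alpha) * n%:R <=
  #|[set v : V | 1 - delta + gamma <= reldeg R k H (i, [set v])]|%:R.
Proof.
have [_ _ _ _ [f5 _]] := C_family; have [/andP[g0 gg] g1] := gamma_bounds.
have [c0 cS cE] := cl_sys i; have /andP[b0 b1] := beta01.
have k20 : (0 < k - 2)%N by move: k3; clear; lia.
apply: (@le_trans _ _ #|[set v | cl i [set v]]|%:R).
  have cb : (#|[set v | ~~ cl i [set v]]| <= b)%N.
    have := cE set0; rewrite cards0 => /(_ k20 c0); congr (_ <= _)%N.
    by apply: eq_card => v; rewrite !inE setU0.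
  have : n%:R <= #|[set v | cl i [set v]]|%:R + b%:R :> R.
    rewrite -natrD ler_nat -V_card -(cardsC [set v | cl i [set v]]) leq_add2l.
    by apply: leq_trans cb; apply: subset_leq_card; apply/subsetP => v;
      rewrite !inE.
  have : b%:R <= alpha * n%:R.
    apply: le_trans b_small _; apply: ler_pM => //.
    by rewrite ler_nat leq_subr.
  lra.
rewrite ler_nat; apply: subset_leq_card; apply/subsetP => v; rewrite !inE => cv.
have g'0 : 0 <= gamma' by move: g0 gg; lra.
(* Truncated at 0, since the averaging takes a nonnegative bound while [delta] may exceed
   [1 + gamma']. *)
pose y := Num.max (1 - delta + gamma') 0.
have y0 : 0 <= y by rewrite le_max lexx orbT.
rewrite /reldeg deg_slice /= V_card.
apply: le_trans (clean_degree_lower (i := i) (y := y) _ y0 _ cv _); last first.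
- by rewrite cards1.
- move=> S cSS Sk; have gS : good i S by [].
  have inj : {in C (i, S) &, injective (fun e => S :|: e)}.
    move=> e f eC fC ef; have [_ de _] := vicinity_edge gS eC.
    have [_ df _] := vicinity_edge gS fC.
    have : (S :|: e) :\: S = (S :|: f) :\: S by rewrite ef.
    by rewrite !setDUl !setDv !set0U !(setDidPl _)// disjoint_sym.
  apply: (@le_trans _ _ #|C (i, S)|%:R); last first.
    rewrite -(card_in_imset inj) ler_nat; apply: subset_leq_card.
    apply/subsetP => _ /imsetP[e eC ->]; have [_ _ SeH] := vicinity_edge gS eC.
    by rewrite in_set in_set SeH subsetUl.
  have := f5 i _ (good_shadow_at gS); rewrite /edge_density2 V_card.
  have n2 : 0 < 'C(n, 2)%:R :> R by rewrite ltr0n bin_gt0; move: kn k3; clear;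
    lia.
  rewrite ler_pdivlMr// => C2.
  apply: (@le_trans _ _ (y * 'C(n, 2)%:R)).
    by apply: ler_wpM2l => //; rewrite ler_nat leq_bin2l ?leq_subr.
  by rewrite /y; case: (leP (1 - delta + gamma') 0) => _; rewrite ?mul0r.
- by apply: slice_uniform; exact: vicinity_graph_unif.
have q0 : 0 <= (1 - beta) ^+ (k - 2) by rewrite exprn_ge0 ?subr_ge0.
have q1 : (1 - beta) ^+ (k - 2) <= 1 by rewrite exprn_ile1 ?subr_ge0// gerBl.
move: beta_gamma; set q := (1 - beta) ^+ (k - 2) in q0 q1 * => bg.
rewrite /y; case: (leP (1 - delta + gamma') 0) => [h|/ltW h].
  by rewrite mul0r; move: h gg g'0; lra.
have : (1 - q) * (1 - delta + gamma') <= (1 - q) * (1 + gamma').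
  by apply: ler_wpM2l; move: q1 delta0; lra.
move: bg; lra.
Qed.

(** A single set [S] that is clean for both colors, completed by a common edge of its two
    vicinities, gives an edge of both links. *)
Lemma vicinity_links_share i j :
  share_edge (link k H (i, finset.set0)) (link k H (j, finset.set0)).
Proof.
have [_ f2 _ _ [_ f6]] := C_family.
have to_link l X : (l, X) \in H -> X \in link k H (l, finset.set0).
  by move=> XH; rewrite in_set /= cards0 subn0 setU0 XH (vicinity_graph_unif
    XH) eqxx.
have [c0 _ cE] := clean_systemI (cl_sys i) (cl_sys j).
have [||||S [_ _ Sk /andP[ci cj]]] :=
    @greedy_extension V (fun X => cl i X && cl j X) setT set0 (b + b) (k - 2).
- by move=> Y _; exact: cE.
- exact: c0.
- by rewrite cards0.
- by rewrite cardsT V_card; move: n_large k3; clear; lia.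
have gi : good i S by []; have gj : good j S by [].
have [e [ei ej]] : share_edge (C (i, S)) (C (j, S)).
  have [ij|ij] := eqVneq i j; last first.
    by apply: (f6 i j) => //; exact: good_shadow_at.
  by rewrite -ij; apply: (f2 i); exact: good_shadow_at.
have [[_ _ iH] [_ _ jH]] := (vicinity_edge gi ei, vicinity_edge gj ej).
by exists (S :|: e); split; exact: to_link.
Qed.

Lemma vicinity_framework : rainbow_framework k H alpha gamma delta.
Proof.
split.
- exact: vicinity_tightly_connected.
- exact: vicinity_closed_walk.
- by split=> // i; exact: vicinity_matchable.
- exact: vicinity_point_degrees.
- exact: vicinity_links_share.
Qed.

End CleanGraphs.

(** * Cleaning *)

Section CleanSets.

Variables (R : realType) (k : nat) (V : finType) (G : {set {set V}}) (theta :
  R).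
Let t := #|V|.
Hypothesis k3 : (3 <= k)%N.
Hypothesis G_unif : uniform k G.
Hypothesis theta0 : 0 < theta.
Hypothesis t0 : (0 < t)%N.

(* With these thresholds, a set that is not crowded has at most [k theta t]
   crowded one-point extensions. *)
Definition crowded (J : {set V}) : bool :=
  theta ^+ (k - 1 - #|J|) * t%:R ^+ (k - #|J|) <= (degree G J)%:R.

Definition clean (X : {set V}) : bool :=
  [forall T : {set V}, (T \subset X) && (#|T| <= k - 2)%N ==> ~~ crowded T].

Lemma cleanP (X : {set V}) :
  reflect (forall T : {set V}, T \subset X -> (#|T| <= k - 2)%N -> ~~ crowded T)
    (clean X).
Proof.
apply: (iffP forallP) => h T; first by move=> TX Tk; have /implyP := h T;
  rewrite TX Tk; apply.
by apply/implyP => /andP[]; exact: h.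
Qed.

Lemma cleanS (X Y : {set V}) : X \subset Y -> clean Y -> clean X.
Proof.
move=> XY /cleanP h; apply/cleanP => T TX; apply: h; exact: subset_trans XY.
Qed.

Lemma clean0 : #|G|%:R < theta ^+ (k - 1) * t%:R ^+ k -> clean set0.
Proof.
move=> Gk; apply/cleanP => T; rewrite subset0 => /eqP-> _.
rewrite /crowded cards0 !subn0 -ltNge; apply: le_lt_trans Gk.
rewrite ler_nat; apply: subset_leq_card; apply/subsetP => X.
by rewrite inE => /andP[].
Qed.

(** The threshold of [T] is [theta * t] times that of a one-point extension, and the degrees of all
    extensions add up to at most [k] times the degree of [T]. *)
Lemma crowded_extensions (T : {set V}) : ~~ crowded T -> (#|T| < k - 2)%N ->
  #|[set a in ~: T | crowded (a |: T)]|%:R <= k%:R * theta * t%:R.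
Proof.
set j := #|T|; rewrite /crowded -ltNge -/j => Tlow jk.
set N := #|_|.
have tR : 0 < t%:R :> R by rewrite ltr0n.
have kj : (k - 1 - j = (k - 1 - j.+1).+1)%N by move: jk; clear; lia.
have kj' : (k - j = (k - j.+1).+1)%N by move: jk; clear; lia.
set th := theta ^+ (k - 1 - j.+1) * t%:R ^+ (k - j.+1).
have th0 : 0 < th by rewrite mulr_gt0// exprn_gt0.
rewrite -(ler_pM2r th0).
apply: (@le_trans _ _ ((k - j) * degree G T)%:R).
  rewrite (degree_sum _ G_unif) natr_sum (bigID (fun a => crowded (a |: T))) /=.
  rewrite -[leLHS]addr0 lerD ?sumr_ge0//.
  rewrite mulr_natl -sumr_const [leLHS](eq_bigl (fun a => (a \in ~: T) &&
    crowded (a |: T))).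
    apply: ler_sum => a; rewrite inE => /andP[aT].
    by rewrite /crowded cardsU1 aT add1n.
  by move=> a; rewrite !inE.
rewrite natrM; apply: (@le_trans _ _ (k%:R * (theta * t%:R * th))); last first.
  by rewrite !mulrA.
apply: ler_pM => //; first by rewrite ler_nat leq_subr.
by apply/ltW/(lt_le_trans Tlow); rewrite kj kj' !exprS /th mulrACA.
Qed.

(** If [X] is clean and [a |: X] is not, a crowded subset of the latter contains [a]; removing [a]
    leaves one of at most [2 ^ k] subsets of [X], to which [crowded_extensions] applies. *)
Lemma clean_extensions (X : {set V}) : clean X -> (#|X| < k)%N ->
  #|[set a | ~~ clean (a |: X)]|%:R <= (2 ^ k * k)%:R * theta * t%:R.
Proof.
move=> /cleanP cX Xk.
pose A (T : {set V}) := if (#|T| < k - 2)%N then [set a in ~: T | crowded (a |: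
  T)] else set0.
have sub : [set a | ~~ clean (a |: X)] \subset \bigcup_(T in powerset X) A T.
  apply/subsetP => a; rewrite inE => /forallPn[T]; rewrite negb_imply negbK.
  move=> /andP[/andP[TX Tk] Tc].
  have aT : a \in T.
    apply: contraT => aT; move: (cX T); rewrite Tc Tk; apply=> //.
    by apply/subsetP => v vT; have /setU1P[va|//] := subsetP TX _ vT;
      rewrite -va vT in aT.
  apply/bigcupP; exists (T :\ a); first by rewrite powersetE subDset.
  have Tk' : (#|T :\ a| < k - 2)%N by move: Tk; rewrite (cardsD1 a) aT.
  by rewrite /A Tk' !inE eqxx /= setD1K.
apply: (@le_trans _ _ (\sum_(T in powerset X) #|A T|)%:R).
  rewrite ler_nat; apply: leq_trans (subset_leq_card sub) _.
  apply: (big_ind2 (fun (B : {set V}) n => #|B| <= n)%N) => //.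
    by rewrite cards0.
  move=> B1 n1 B2 n2 h1 h2.
  exact: leq_trans (leq_card_setU _ _) (leq_add h1 h2).
rewrite natr_sum; apply: (@le_trans _ _ (\sum_(T in powerset X) k%:R * theta *
  t%:R)).
  apply: ler_sum => T; rewrite powersetE => TX.
  rewrite /A; case: ifP => Tk; last by rewrite cards0 !mulr_ge0// ltW.
  by apply: crowded_extensions => //; apply: cX => //; exact: ltnW.
rewrite sumr_const card_powerset -[leLHS]mulr_natl natrM -!mulrA.
apply: ler_wpM2r; first by rewrite !mulr_ge0// ltW.
by rewrite ler_nat leq_exp2l// ltnW.
Qed.

Lemma clean_degree (S : {set V}) : clean S -> #|S| = (k - 2)%N ->
  (degree G S)%:R <= theta * t%:R ^+ 2.
Proof.
move=> /cleanP/(_ S (subxx _)) h Sk; have := h _; rewrite Sk leqnn => /(_ isT).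
rewrite /crowded -ltNge Sk (_ : k - 1 - (k - 2) = 1)%N; last by move: k3;
  clear; lia.
by rewrite subKn ?(ltnW k3)// expr1 => /ltW.
Qed.

End CleanSets.

(** * Restriction to selected colors and points *)

Section Restriction.

Variables (k t n b : nat) (V V' : finType) (E I : {set cset t V}).
Variables (c : 'I_t -> {set V} -> bool) (f : 'I_n -> 'I_t) (g : V' -> V).
Hypothesis k3 : (3 <= k)%N.
Hypothesis V_card : #|V| = t.
Hypothesis V'_card : #|V'| = n.
Hypothesis g_inj : injective g.
Hypothesis E_unif : is_1kgraph k E.
Hypothesis c0 : forall i, c (f i) set0.
Hypothesis cS : forall i (X Y : {set V}), X \subset Y -> c i Y -> c i X.
Hypothesis cE : forall i (X : {set V}), c i X -> (#|X| < k)%N ->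
  (#|[set a | ~~ c i (a |: X)]| <= b)%N.

Definition clean_restriction : {set cset n V'} :=
  [set e : cset n V' | ((f e.1, g @: e.2) \in E :\: I) && c (f e.1) (g @: e.2)].
Let E' := clean_restriction.

Lemma clean_restriction_unif : is_1kgraph k E'.
Proof.
by move=> e; rewrite !inE => /andP[/andP[_ /E_unif /=]]; rewrite card_imset.
Qed.

Lemma clean_restriction_system i :
  clean_system (k - 2) b (fun X : {set V'} => c (f i) (g @: X)).
Proof.
split; first by rewrite imset0.
  by move=> X Y XY; apply: cS; exact: imsetS.
move=> X Xk cX; rewrite -(card_imset _ g_inj).
apply: leq_trans (cE cX _); last first.
  by rewrite card_imset//; move: Xk; clear; lia.
apply: subset_leq_card; apply/subsetP => _ /imsetP[a + ->].
by rewrite !inE imsetU1.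
Qed.

(** A lost edge through the clean set lies in [I], or uses one of the [t - n] discarded points, or
    is unclean. In the last case it adds two points [p], [q], and cleanness fails either with [p] or
    only with [q]; each alternative has at most [b * t] pairs. *)
Lemma clean_restriction_degree i (S' : {set V'}) :
  c (f i) (g @: S') -> #|S'| = (k - 2)%N ->
  (degree (color_slice E (f i)) (g @: S') <= degree (color_slice E' i) S' +
     degree (color_slice I (f i)) (g @: S') + (t - n) * t + 2 * (b * t))%N.
Proof.
move=> cS' Sk; set S := g @: S' in cS' *.
have {}Sk : #|S| = (k - 2)%N by rewrite card_imset.
pose W := [set g v | v in V'].
pose add (pq : V * V) := pq.2 |: (pq.1 |: S).
pose Q1 := [set pq : V * V | ~~ c (f i) (pq.1 |: S)].
pose Q2 := [set pq : V * V | c (f i) (pq.1 |: S) && ~~ c (f i) (add pq)].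
have cardW : #|~: W| = (t - n)%N.
  by rewrite cardsCs setCK card_imset// V_card -V'_card.
have cardQ1 : (#|Q1| <= b * t)%N.
  rewrite (_ : Q1 = setX [set p | ~~ c (f i) (p |: S)] setT).
    by rewrite cardsX cardsT V_card leq_mul2r cE ?orbT// Sk; move: k3; clear;
      lia.
  by apply/setP => -[p q]; rewrite !inE andbT.
have cardQ2 : (#|Q2| <= b * t)%N.
  rewrite -sum1dep_card -(pair_big_dep predT (fun p q => c (f i) (p |: S) &&
    ~~ c (f i) (add (p, q))) (fun _ _ => 1%N)) /= mulnC -V_card -sum_nat_const.
  apply: leq_sum => p _; rewrite sum1dep_card.
  have [cp|cp] := boolP (c (f i) (p |: S)) => /=; last first.
    by rewrite (_ : [set _ | _] = set0) ?cards0//; apply/setP => q;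
      rewrite !inE.
  rewrite /add /=; apply: cE => //; rewrite cardsU1 Sk;
    move: k3 (leq_b1 (p \notin S)); clear; lia.
have pairE X p : X \in color_slice E (f i) -> S \subset X -> p \in X :\: S ->
    exists q, X = add (p, q).
  rewrite in_set => XE SX pX; have Xk : #|X| = k by exact: (E_unif XE).
  have : #|(X :\: S) :\ p| = 1%N.
    have := cardsD1 p (X :\: S); rewrite pX cardsD (setIidPr SX) Xk Sk.
    by move: k3; clear; lia.
  move=> /eqP/cards1P[q qE]; exists q; rewrite /add /=.
  by rewrite setUCA -qE setUA (setUC _ S) setD1K// -{1}(setIidPr SX) setID.
set D := [set X in color_slice E (f i) | S \subset X].
have subD : D \subset ([set g @: X | X : {set V'} in [set X in color_slice E' i
  | S' \subset X]]
     :|: [set X in color_slice I (f i) | S \subset X]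
     :|: [set add pq | pq in setX (~: W) setT]) :|: ([set add pq | pq in Q1]
       :|: [set add pq | pq in Q2]).
  apply/subsetP => X; rewrite inE => /andP[XE SX].
  have [XI|XI] := boolP ((f i, X) \in I); first by rewrite !inE XI SX !orbT.
  have [XW|/subsetPn[p pX pW]] := boolP (X \subset W); last first.
    have [|q XE'] := pairE X p XE SX.
      rewrite inE pX andbT; apply: contra pW => /imsetP[u _ ->].
      exact: imset_f.
    apply/setUP; left; apply/setUP; right; apply/imsetP; exists (p, q) => //.
    by rewrite !inE pW.
  have [cX|cX] := boolP (c (f i) X).
    apply/setUP; left; apply/setUP; left; apply/setUP; left.
    have XE' : g @: (g @^-1: X) = X.
      apply/setP => v; apply/imsetP/idP => [[u + ->]|vX]; first by rewrite inE.
      by have /imsetP[u _ vE] := subsetP XW _ vX; exists u; rewrite // inE -vE.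
    apply/imsetP; exists (g @^-1: X) => //.
    rewrite in_set in_set in_set /= XE' in_setD XI cX /=.
    rewrite in_set in XE; rewrite XE /=; apply/subsetP => v vS.
    by rewrite inE (subsetP SX)// imset_f.
  have [p pX] : exists p, p \in X :\: S.
    apply/card_gt0P; rewrite cardsD (setIidPr SX) Sk; move: XE.
    by rewrite in_set => /E_unif /= ->; move: k3; clear; lia.
  have [q XE'] := pairE X p XE SX pX.
  apply/setUP; right; have [cp|cp] := boolP (c (f i) (p |: S)).
    apply/setUP; right; apply/imsetP; exists (p, q) => //.
    by rewrite inE /= cp -XE'.
  by apply/setUP; left; apply/imsetP; exists (p, q) => //; rewrite inE.
apply: leq_trans (subset_leq_card subD) _.
rewrite mul2n -addnn; apply: leq_trans (leq_card_setU _ _) _; apply: leq_add;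
  last first.
  apply: leq_trans (leq_card_setU _ _) _; apply: leq_add.
    exact: leq_trans (leq_imset_card _ _) _.
  exact: leq_trans (leq_imset_card _ _) _.
apply: leq_trans (leq_card_setU _ _) _; apply: leq_add; last first.
  apply: leq_trans (leq_imset_card _ _) _.
  by rewrite cardsX cardW cardsT V_card.
apply: leq_trans (leq_card_setU _ _) _; rewrite leq_add2r.
exact: leq_imset_card.
Qed.

End Restriction.

(** * Numerical estimates and selections *)

Lemma bin_le_exp n k : ('C(n, k) <= n ^ k)%N.
Proof.
elim: k => [|k IH]; first by rewrite bin0.
apply: (@leq_trans (k.+1 * 'C(n, k.+1))); first exact: leq_pmull.
by rewrite mul_bin_left expnS leq_mul ?leq_subr.
Qed.

Lemma bernoulli_inequality (R : realFieldType) (x : R) m : 0 <= x <= 1 ->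
  1 - m%:R * x <= (1 - x) ^+ m.
Proof.
move=> /andP[x0 x1]; elim: m => [|m IH]; first by rewrite mul0r subr0 expr0.
have h : (1 - x) * (1 - m%:R * x) <= (1 - x) ^+ m.+1.
  by rewrite exprS; apply: ler_wpM2l => //; rewrite subr_ge0.
apply: le_trans h; rewrite -natr1.
have : 0 <= m%:R * x * x by rewrite !mulr_ge0.
lra.
Qed.

Lemma bin2_lower (R : realFieldType) (t k : nat) : (3 <= k)%N -> (2 * k <= t)%N
  ->
  t%:R ^+ 2 <= 8%:R * 'C(t - (k - 2), 2)%:R :> R.
Proof.
move=> k3 kt; rewrite -natrX -natrM ler_nat.
have := mul_bin_diag (t - (k - 2)) 1; rewrite bin1 => E.
have -> : (8 * 'C(t - (k - 2), 2) = 4 * (2 * 'C(t - (k - 2), 2)))%N by lia.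
rewrite -E; set s := (t - (k - 2))%N.
apply: (@leq_trans ((2 * s) * (2 * s.-1))).
  by rewrite expnS expn1; apply: leq_mul; rewrite /s; move: k3 kt; clear; lia.
by rewrite mulnACA -mulnA.
Qed.

Lemma sum_color_slices t (V : finType) (I : {set cset t V}) :
  (\sum_c #|color_slice I c| = #|I|)%N.
Proof.
rewrite -sum1_card (partition_big (fun e => e.1) predT) //=.
apply: eq_bigr => c _; rewrite [RHS]sum1dep_card.
rewrite -(card_imset _ (f := fun X : {set V} => (c, X))); last by move=> X Y [].
apply: eq_card => -[c' X]; rewrite in_set; apply/imsetP/idP.
  by case=> Y; rewrite in_set => YI [-> ->]; rewrite YI eqxx.
by move=> /andP[XI /eqP/= cE]; exists X; rewrite ?in_set -cE.
Qed.

(** [enum F] is increasing, being a subsequence of the enumeration of ['I_t]. *)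
Lemma increasing_selection t n (F : {set 'I_t}) : (n <= #|F|)%N ->
  exists f : 'I_n -> 'I_t, (forall i, f i \in F) /\
    (forall i j : 'I_n, (i < j)%N -> (f i < f j)%N).
Proof.
move=> nF; exists (fun i => enum_val (widen_ord nF i)); split=> [i|i j ij].
  exact: enum_valP.
pose s := map val (enum F).
have ss : sorted ltn s.
  apply: (subseq_sorted ltn_trans (s2 := map val (enum 'I_t))).
    by apply: map_subseq; rewrite enumT; exact: filter_subseq.
  by rewrite val_enum_ord; exact: iota_ltn_sorted.
have sE (l : 'I_n) : val (enum_val (widen_ord nF l)) = nth 0%N s l.
  rewrite (enum_val_nth (enum_val (widen_ord nF l))) (nth_map (enum_val
    (widen_ord nF l)))//.
  by rewrite -cardE; exact: leq_trans nF.
rewrite /= !sE; apply: (sorted_ltn_nth ltn_trans 0%N ss) => //.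
  by rewrite inE size_map -cardE (leq_trans _ nF).
by rewrite inE size_map -cardE (leq_trans _ nF).
Qed.

Lemma injective_selection (V : finType) n (W : {set V}) : (n <= #|W|)%N ->
  exists2 g : 'I_n -> V, injective g & forall i, g i \in W.
Proof.
move=> nW; exists (fun i => enum_val (widen_ord nW i)) => [i j /enum_val_inj|i].
  by move=> [ij]; apply: val_inj.
exact: enum_valP.
Qed.

(** * Light colors and covered points *)

Section Selection.

Variables (R : realType) (k t b : nat) (V : finType) (I : {set cset t V}).
Variables (theta sigma : R).
Hypothesis k3 : (3 <= k)%N.
Hypothesis t0 : (0 < t)%N.
Hypothesis V_card : #|V| = t.
Hypothesis I_unif : is_1kgraph k I.
Hypothesis theta0 : 0 < theta.
Hypothesis sigma0 : 0 < sigma.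
Hypothesis theta_sigma : (2 ^ k * k)%:R * theta = sigma ^+ 2.
Hypothesis I_small : #|I|%:R <= sigma * theta ^+ (k - 1) * t%:R * 'C(t, k)%:R.
Hypothesis b_sigma : sigma * t%:R < b.+1%:R.

(** The threshold is that of [crowded] at the empty set. *)
Definition light_colors : {set 'I_t} :=
  [set c | #|color_slice I c|%:R < theta ^+ (k - 1) * t%:R ^+ k].

Definition covered_points : {set V} :=
  [set v | (#|[set c in light_colors |
    ~~ clean k (color_slice I c) theta [set v]]| <= b)%N].

Let tR : 0 < t%:R :> R. Proof. by rewrite ltr0n. Qed.

(** Markov's inequality for the number of edges of [I] at a color. *)
Lemma light_colors_card : (1 - sigma) * t%:R <= #|light_colors|%:R.
Proof.
have th0 : 0 < theta ^+ (k - 1) * t%:R ^+ k by rewrite mulr_gt0// exprn_gt0.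
suff : #|~: light_colors|%:R <= sigma * t%:R.
  have := cardsC light_colors; rewrite card_ord => E.
  have : t%:R = #|light_colors|%:R + #|~: light_colors|%:R :> R by rewrite
    -natrD E.
  lra.
rewrite -(ler_pM2r th0) mulr_natl -sumr_const.
apply: (@le_trans _ _ #|I|%:R).
  rewrite -sum_color_slices natr_sum [leRHS](bigID (mem (~: light_colors))) /=.
  rewrite -[leLHS]addr0 lerD ?sumr_ge0//; apply: ler_sum => c.
  by rewrite !inE -leNgt.
apply: le_trans I_small _.
have -> : sigma * t%:R * (theta ^+ (k - 1) * t%:R ^+ k) =
  sigma * theta ^+ (k - 1) * t%:R * t%:R ^+ k by ring.
apply: ler_wpM2l; first by rewrite !mulr_ge0// ?exprn_ge0// ltW.
by rewrite -natrX ler_nat bin_le_exp.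
Qed.

Let slice_unif c : uniform k (color_slice I c).
Proof. by move=> X; rewrite in_set => /I_unif. Qed.

Lemma light_clean0 c : c \in light_colors -> clean k (color_slice I c) theta
  set0.
Proof. by rewrite inE => h; apply: clean0; rewrite V_card. Qed.

Lemma slice_clean_extensions c (X : {set V}) :
  clean k (color_slice I c) theta X -> (#|X| < k)%N ->
  #|[set a | ~~ clean k (color_slice I c) theta (a |: X)]|%:R <= sigma ^+ 2 *
    t%:R.
Proof.
move=> cX Xk; have := clean_extensions (@slice_unif c) theta0 _ cX Xk.
by rewrite V_card theta_sigma; apply.
Qed.

(** Each uncovered point is unclean for more than [sigma * t] light colors, while there are at most
    [sigma ^+ 2 * t ^+ 2] pairs of a light color and a point unclean for it. *)
Lemma covered_points_card : sigma <= 1 -> (1 - sigma) * t%:R <=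
  #|covered_points|%:R.
Proof.
move=> sigma1.
suff : #|~: covered_points|%:R <= sigma * t%:R.
  have := cardsC covered_points; rewrite V_card => E.
  have : t%:R = #|covered_points|%:R + #|~: covered_points|%:R :> R by rewrite
    -natrD E.
  lra.
have st0 : 0 < sigma * t%:R by rewrite mulr_gt0.
rewrite -(ler_pM2r st0).
pose B v := [set c in light_colors | ~~ clean k (color_slice I c) theta [set
  v]].
apply: (@le_trans _ _ (\sum_v #|B v|)%:R).
  rewrite mulr_natl -sumr_const natr_sum [leRHS](bigID (mem (~:
    covered_points))) /=.
  rewrite -[leLHS]addr0 lerD ?sumr_ge0//; apply: ler_sum => v.
  rewrite !inE -ltnNge => bv; apply/ltW/(lt_le_trans b_sigma).
  by rewrite ler_nat.
have -> : (\sum_v #|B v| = \sum_(c in light_colors)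
    #|[set v | ~~ clean k (color_slice I c) theta [set v]]|)%N.
  under eq_bigr => v _ do rewrite -sum1dep_card.
  rewrite (exchange_big_dep (mem light_colors))/=; last by move=> v c _ /andP[].
  apply: eq_bigr => c cl; rewrite -sum1dep_card; apply: eq_bigl => v.
  by rewrite cl.
rewrite natr_sum; apply: (@le_trans _ _ (\sum_(c in light_colors) sigma ^+ 2 *
  t%:R)).
  apply: ler_sum => c cl.
  have := slice_clean_extensions (light_clean0 cl); rewrite cards0.
  have -> : [set a | ~~ clean k (color_slice I c) theta (a |: set0)] =
    [set v | ~~ clean k (color_slice I c) theta [set v]].
    by apply/setP => v; rewrite !inE setU0.
  by apply; move: k3; clear; lia.
rewrite sumr_const -[leLHS]mulr_natl.
rewrite (_ : sigma * t%:R * (sigma * t%:R) = t%:R * (sigma ^+ 2 * t%:R));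
  last by ring.
apply: ler_wpM2r; first by rewrite mulr_ge0// exprn_ge0// ltW.
by rewrite ler_nat -[leqRHS]card_ord max_card.
Qed.

End Selection.

(** * Choice of constants *)

(** The relative degree bound drops from [delta + mu] to [delta + 3 / 4 * mu] through deletions, and
    to [delta + mu / 2] through averaging over clean sets. *)
Lemma rhf_property_of_rhv (R : realType) (k : nat) (delta : R) : (3 <= k)%N ->
  0 < delta -> rhv_property k delta -> rhf_property k delta.
Proof.
move=> k3 delta0 rhvP mu /andP[mu0 mu1].
have [g' /andP[g'0 g'1] Hg] := rhvP (mu / 2) ltac:(apply/andP; split; lra).
have {Hg} [a0 /andP[a00 a01] Ha] := Hg g' ltac:(by rewrite g'0 lexx).
have {Ha} [T0 /andP[T00 T01] HT] := Ha a0 ltac:(by rewrite a00 lexx).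
exists (g' / 2) => [|gamma /andP[gamma0 gamma1]]; first by apply/andP; split;
  lra.
exists 1 => [|alpha /andP[alpha0 alpha1]]; first by rewrite ltr01 lexx.
have K3 : 3%:R <= k%:R :> R by rewrite ler_nat.
set K : R := k%:R in K3.
(* A product of constants in the unit interval lies below each of them. *)
pose s0 := a0 * alpha * (mu * g').
have [s00 s0a s0al s0mu s0g] : [/\ 0 < s0, s0 <= a0, s0 <= alpha, s0 <= mu & s0
  <= g'].
  have h1 : 0 < a0 * alpha by rewrite mulr_gt0.
  have h2 : 0 < mu * g' by rewrite mulr_gt0.
  have h1' : a0 * alpha <= 1 by apply: mulr_ile1 => //; exact: ltW.
  have h2' : mu * g' <= 1 by apply: mulr_ile1 => //; exact: ltW.
  have l1 : s0 <= a0 * alpha by rewrite /s0; apply: ler_piMr => //; exact: ltW.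
  have l2 : s0 <= mu * g' by rewrite /s0; apply: ler_piMl => //; exact: ltW.
  split; first by rewrite mulr_gt0.
  - by apply: le_trans l1 _; apply: ler_piMr => //; exact: ltW.
  - by apply: le_trans l1 _; apply: ler_piMl => //; exact: ltW.
  - by apply: le_trans l2 _; apply: ler_piMr => //; exact: ltW.
  - by apply: le_trans l2 _; apply: ler_piMl => //; exact: ltW.
(* The factor [delta + 1] appears because the averaging loss multiplies [x], which contains
   [delta]. *)
pose sigma := s0 / (200%:R * K * (delta + 1)).
have D0 : 0 < 200%:R * K * (delta + 1) by rewrite !mulr_gt0//; lra.
have sigma0 : 0 < sigma by rewrite divr_gt0.
have sigmaE : 200%:R * (K * sigma * delta) + 200%:R * (K * sigma) = s0.
  by rewrite (_ : _ + _ = sigma * (200%:R * K * (delta + 1)));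
    [rewrite mulfVK ?gt_eqF|ring].
have Ks0 : 0 < K * sigma by rewrite mulr_gt0//; lra.
have Ksd0 : 0 < K * sigma * delta by rewrite mulr_gt0.
have Ks3 : 3%:R * sigma <= K * sigma by rewrite ler_pM2r.
have sigma1 : sigma <= 1 by lra.
pose P : R := (2 ^ k * k)%:R.
have P1 : 1 <= P by rewrite ler1n muln_gt0 expn_gt0 /=; move: k3; clear; lia.
(* Clean sets of size below [k] then have at most [sigma ^+ 2 * t] unclean one-point extensions; one
   factor [sigma] is spent in [covered_points_card]. *)
pose theta := sigma ^+ 2 / P.
have theta0 : 0 < theta by rewrite divr_gt0 ?exprn_gt0//; lra.
have thetaE : P * theta = sigma ^+ 2 by rewrite /theta mulrCA divff ?mulr1//
  gt_eqF//; lra.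
have theta_sigma : theta <= sigma.
  apply: (@le_trans _ _ (P * theta)); first by apply: ler_peMl => //;
    exact: ltW.
  by rewrite thetaE expr2 ler_piMr// ltW.
have theta1 : theta <= 1 by apply: le_trans sigma1.
exists (sigma * theta ^+ (k - 1)) => [|eps /andP[eps0 epsle]].
  rewrite mulr_gt0 ?exprn_gt0//=; apply: mulr_ile1 => //; first exact: ltW.
    by rewrite exprn_ge0// ltW.
  by rewrite exprn_ile1// ltW.
have K16 : 0 < 16%:R * K ^+ 2 by rewrite mulr_gt0// exprn_gt0//; lra.
have K2 : K <= K ^+ 2 by rewrite expr2 ler_peMl//; lra.
(* This makes [sigma * t] at least [16 * k ^ 2], and [t / 2], a lower bound for [n], large enough
   for [T0]. *)
exists (T0 * sigma / (16%:R * K ^+ 2)).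
  apply/andP; split; first by apply: divr_gt0 => //; exact: mulr_gt0.
  rewrite ler_pdivrMr// mul1r; apply: (@le_trans _ _ 1);
    first by apply: mulr_ile1 => //; exact: ltW.
  by lra.
move=> t t0 tT V E I V_card E_unif E_deg IE I_le.
have tR : 0 < t%:R :> R by rewrite ltr0n.
set T : R := t%:R in tR tT I_le *.
have [Ku uT TT] : [/\ 16%:R * K ^+ 2 <= sigma * T, 200%:R * K * (sigma * T) <=
  T & 2 <= T0 * T].
  have h : 16%:R * K ^+ 2 <= T0 * (sigma * T).
    move: tT; rewrite -[T^-1]mul1r ler_pdivrMr// mulrAC ler_pdivlMr// mul1r.
    by rewrite mulrA.
  have st0 : 0 <= sigma * T by rewrite mulr_ge0// ltW.
  split.
  - by apply: le_trans h _; rewrite ler_piMl.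
  - rewrite (_ : _ * (sigma * T) = (200%:R * (K * sigma)) * T); last by ring.
    by rewrite ler_piMl ?(ltW tR)//; lra.
  have : T0 * (sigma * T) <= T0 * T by rewrite ler_pM2l// ler_piMl// ltW.
  by lra.
set u := sigma * T in Ku uT.
have u0 : 0 <= u by rewrite mulr_ge0// ltW.
have Ku3 : 3%:R * u <= K * u by rewrite ler_wpM2r.
pose b := Num.trunc u.
have b_le : b%:R <= u by rewrite truncn_le.
have b_gt : u < b.+1%:R by exact: truncnS_gt.
have I_unif : is_1kgraph k I by move=> e eI; apply: E_unif;
  exact: (fintype.subsetP IE).
have I_small : #|I|%:R <= sigma * theta ^+ (k - 1) * T * 'C(t, k)%:R.
  apply: le_trans I_le _; apply: ler_wpM2r; first by [].
  by apply: ler_wpM2r; [exact: ltW|exact: epsle].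
pose c i := clean k (color_slice I i) theta.
pose F := light_colors k I theta; pose W := covered_points k b I theta.
have F_card : (1 - sigma) * T <= #|F|%:R.
  exact: light_colors_card theta0 sigma0 I_small.
have W_card : (1 - sigma) * T <= #|W|%:R.
  exact: covered_points_card.
have c0 i : i \in F -> c i set0 by exact: light_clean0.
have cS i (X Y : {set V}) : X \subset Y -> c i Y -> c i X by exact: cleanS.
have cE i (X : {set V}) : c i X -> (#|X| < k)%N -> (#|[set a | ~~ c i (a |:
  X)]| <= b)%N.
  move=> cX Xk; rewrite -ltnS -(ltr_nat R); apply: le_lt_trans b_gt.
  apply: le_trans (slice_clean_extensions t0 V_card I_unif theta0 thetaE cX Xk)
    _.
by rewrite expr2 -mulrA ler_piMl.
(* A framework needs [k] to divide its number of colors; rounding down loses at most [k], which is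
   below [u]. *)
pose m0 := minn #|F| #|W|; pose n := (k * (m0 %/ k))%N.
have n_m0 : (n <= m0)%N by rewrite /n mulnC leq_trunc_div.
have m0_n : (m0 <= n + k)%N.
  rewrite {1}(divn_eq m0 k) mulnC leq_add2l ltnW// ltn_mod.
  by move: k3; clear; lia.
have k_n : (k %| n)%N by exact: dvdn_mulr.
clearbody n.
have m0_card : (1 - sigma) * T <= m0%:R by rewrite /m0; case: leqP.
have n_T : T - 2%:R * u <= n%:R.
  have : m0%:R <= n%:R + K by rewrite -natrD ler_nat.
  have : (1 - sigma) * T = T - u by rewrite /u; ring.
  by move: m0_card Ku K2 K16; clear; lra.
have n_le_t : (n <= t)%N.
  apply: leq_trans n_m0 _; apply: leq_trans (geq_minl _ _) _.
  by rewrite -[leqRHS]card_ord max_card.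
have [f [fF f_mono]] := increasing_selection (leq_trans n_m0 (geq_minl _ _)).
have [g g_inj gW] := injective_selection (leq_trans n_m0 (geq_minr _ _)).
have f_inj : injective f.
  move=> i j ij; apply: val_inj; case: (ltngtP (val i) (val j)) => // /f_mono;
  by rewrite ij ltnn.
pose E' := clean_restriction E I c f g.
pose cl i (X : {set 'I_n}) := c (f i) (g @: X).
have cl_sys i : clean_system (k - 2) b (cl i).
  by apply: clean_restriction_system => // j; exact: c0.
have E'_unif : is_1kgraph k E' by exact: clean_restriction_unif.
have E'_clean e : e \in E' -> cl e.1 e.2 by rewrite in_set => /andP[].
have uT' : 600%:R * u <= T.
  by move: Ku3 uT; clear; lra.
have K_u : K <= u by move: Ku K2 K16; clear; lra.
have T_K : 2%:R * K <= T by move: K_u uT' u0; clear; lra.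
have kt : (2 * k <= t)%N by rewrite -(ler_nat R) natrM.
have nT2 : T / 2 <= n%:R by move: n_T uT' u0; clear; lra.
have kn : (k <= n)%N by rewrite -(ler_nat R); move: nT2 T_K; rewrite -/K;
  clear; lra.
pose x := delta + 3%:R / 4%:R * mu.
have x0 : 0 < x by rewrite /x; move: delta0 mu0; clear; lra.
have E'_deg i (S : {set 'I_n}) : cl i S -> #|S| = (k - 2)%N ->
    x * 'C(n - (k - 2), 2)%:R <= (deg E' (i, S))%:R.
  move=> cSS Sk; rewrite deg_slice /=.
  have gSk : #|g @: S| = (k - 2)%N by rewrite card_imset.
  have k2 : (k - (k - 2) = 2)%N by move: k3; clear; lia.
  have Ct0 : 0 < 'C(t - (k - 2), 2)%:R :> R.
    by rewrite ltr0n bin_gt0; move: kt k3; clear; lia.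
  have CT : T ^+ 2 <= 8%:R * 'C(t - (k - 2), 2)%:R by exact: bin2_lower.
  have CnCt : 'C(n - (k - 2), 2)%:R <= 'C(t - (k - 2), 2)%:R :> R.
    by rewrite ler_nat leq_bin2l ?leq_sub2r.
  have := E_deg (f i, g @: S) gSk; rewrite /reldeg deg_slice /= gSk V_card k2.
  rewrite ler_pdivlMr// => Elow.
  have := clean_restriction_degree I k3 V_card (card_ord n) g_inj E_unif cE cSS
    Sk.
  rewrite -(ler_nat R) !natrD !natrM natrB// -/T => up.
  have Iup : (degree (color_slice I (f i)) (g @: S))%:R <= theta * T ^+ 2.
    by have := clean_degree k3 cSS gSk; rewrite V_card.
  have Iup' : theta * T ^+ 2 <= sigma * T ^+ 2 by rewrite ler_wpM2r//
    exprn_ge0// ltW.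
  have nup : (T - n%:R) * T <= 2%:R * (sigma * T ^+ 2).
    rewrite (_ : 2%:R * _ = (2%:R * u) * T); last by rewrite /u; ring.
    by rewrite ler_pM2r//; move: n_T; clear; lra.
  have bup : b%:R * T <= sigma * T ^+ 2.
    by rewrite (_ : sigma * _ = u * T) ?ler_pM2r// /u; ring.
  have sup : sigma * T ^+ 2 <= sigma * (8%:R * 'C(t - (k - 2), 2)%:R).
    by rewrite ler_pM2l.
  (* The losses add up to [5 * sigma * T ^+ 2], hence to at most [40 * sigma] times the binomial
     coefficient; this bound turns them into a quarter of [mu]. *)
  have smu : (160%:R * sigma) * 'C(t - (k - 2), 2)%:R <= mu * 'C(t - (k - 2),
    2)%:R.
    by rewrite ler_pM2r//; move: Ks3 sigmaE Ksd0 s0mu sigma0; clear; lra.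
  have xC : x * 'C(n - (k - 2), 2)%:R <= x * 'C(t - (k - 2), 2)%:R by rewrite
    ler_pM2l.
  apply: le_trans xC _; move: Elow up Iup Iup' nup bup sup smu; rewrite /x.
  set Ct : R := 'C(t - (k - 2), 2)%:R.
  clear; lra.
(* Twice [sigma], as [b] is at most [sigma * T] and [n - (k - 2)] is at least [T / 2]. *)
pose beta := 2%:R * sigma.
have beta01 : 0 <= beta <= 1.
  rewrite /beta; apply/andP; split; move: Ks3 sigmaE Ksd0 s0mu sigma0 mu1;
    clear; lra.
have bern : 1 - 2%:R * (K * sigma) <= (1 - beta) ^+ (k - 2).
  apply: le_trans (bernoulli_inequality (k - 2) beta01).
  rewrite lerD2l lerN2 /beta mulrCA ler_pM2l// ler_pM2r// ler_nat.
  exact: leq_subr.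
have b_small : b%:R <= beta * (n - (k - 2))%:R.
  have : n%:R <= (n - (k - 2))%:R + K :> R.
    by rewrite -natrD ler_nat; clear; lia.
  move=> nk; apply: le_trans b_le _; rewrite /beta /u.
  have : T / 2 <= (n - (k - 2))%:R by move: nk n_T K_u uT' u0; clear; lra.
  by rewrite -(ler_pM2l sigma0); clear; lra.
have b_lt : (4 * b + 3 * k <= n)%N.
  rewrite -(ler_nat R) natrD !natrM -/K; move: b_le nT2 uT' K_u u0; clear; lra.
have b_lt' : (b + (k - 2) <= n)%N by move: b_lt; clear; lia.
have n0 : (0 < n)%N by move: kn k3; clear; lia.
have nT0 : n%:R^-1 <= T0.
  rewrite -[n%:R^-1]mul1r ler_pdivrMr ?ltr0n//.
  have : T0 * (T / 2) <= T0 * n%:R by rewrite ler_pM2l.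
  by move: TT; clear; lra.
set q := (1 - beta) ^+ (k - 2) in bern.
have q1 : q <= 1.
  have /andP[? ?] := beta01.
  by rewrite /q exprn_ile1// ?subr_ge0// gerBl.
have pert1 : beta < a0 by rewrite /beta; move: Ks3 sigmaE Ksd0 s0a sigma0;
  clear; lra.
have pert2 : 1 - q <= a0 by move: bern sigmaE Ksd0 s0a Ks0; clear; lra.
have pert3 : delta + mu / 2 <= x * q.
  have h1 : x * (1 - 2%:R * (K * sigma)) <= x * q by rewrite ler_pM2l.
  have h2 : K * sigma * mu <= K * sigma by rewrite ler_piMr// ltW.
  by apply: le_trans h1; move: h2 sigmaE Ksd0 s0mu Ks0; rewrite /x; clear; lra.
have match_small : (b + (b + k))%:R <= (1 - gamma) * n%:R / k%:R.
  have K0 : 0 < K by move: K3; clear; lra.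
  have gn : n%:R / 2 <= (1 - gamma) * n%:R.
    by rewrite [leLHS]mulrC ler_wpM2r//; move: gamma1 g'1; clear; lra.
  rewrite ler_pdivlMr// !natrD -/K; apply: le_trans gn.
  have bK : b%:R * K <= K * u by rewrite mulrC ler_pM2l.
  by move: bK uT nT2 Ku u0 K16 uT'; clear; lra.
have gap : (1 - q) * (1 + g') <= g' - gamma.
  have h1 : (1 - q) * (1 + g') <= (1 - q) * 2.
    by apply: ler_wpM2l; [rewrite subr_ge0|move: g'1; clear; lra].
  by apply: le_trans h1 _; move: bern sigmaE Ksd0 s0g Ks0 gamma1; clear; lra.
have beta_alpha : beta <= alpha.
  by rewrite /beta; move: Ks3 sigmaE Ksd0 s0al sigma0; clear; lra.
have cl_point (v : 'I_n) : (#|[set i | ~~ cl i [set v]]| <= b)%N.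
  have := gW v; rewrite inE; apply: leq_trans.
  rewrite -(card_imset _ f_inj); apply: subset_leq_card.
  apply/subsetP => _ /imsetP[i + ->]; rewrite !inE /cl imset_set1 => ->.
  by have := fF i; rewrite inE => ->.
have [C C_link C_family] := HT n n0 nT0 'I_n E' (card_ord n) E'_unif
  (clean_perturbed k3 (card_ord n) kn cl_sys E'_unif E'_clean x0 E'_deg beta01
    b_small b_lt' pert1 pert2 pert3).
exists n, 'I_n, f, g, (vicinity_graph k E' C); split.
- split; last exact: card_ord.
  have : 2%:R * u <= alpha * T.
    by rewrite /u mulrA ler_wpM2r.
  by move: n_T; rewrite -/T; clear; lra.
- by [].
- exact: vicinity_graph_unif.
- by move=> e; rewrite in_set => /andP[]; rewrite in_set => /andP[].
apply: (vicinity_framework k3 (card_ord n) kn cl_sys E'_unif E'_clean x0 E'_deg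
  beta01
    b_small b_lt' (gamma' := g')) => //.

- by split=> //; apply/andP; split; [exact: ltW|].
Qed.

(** * Bounds that make the infima genuine *)

Lemma reldeg_le1 (R : realType) k t (V : finType) (E : {set cset t V}) s :
  is_1kgraph k E -> reldeg R k E s <= 1.
Proof.
move=> Ek; rewrite /reldeg deg_slice.
have h := degree_le s.2 (slice_uniform (i := s.1) Ek).
(* If the binomial coefficient vanishes, the quotient is 0 by convention. *)
have [->|C0] := posnP 'C(#|V| - #|s.2|, k - #|s.2|);
  first by rewrite invr0 mulr0.
by rewrite ler_pdivrMr ?ltr0n// mul1r ler_nat.
Qed.

(** The degree condition cannot hold: an edge of the 1-shadow would have relative degree above 1,
    and an empty 1-shadow has a complement of density 1, above [alpha]. *)
Lemma rhv_property1 (R : realType) k : (3 <= k)%N -> rhv_property k (1 : R).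
Proof.
move=> k3 mu /andP[mu0 _].
exists 1 => [|gamma _]; first by rewrite ltr01 lexx.
exists (1 / 2) => [|alpha /andP[_ alpha1]]; first by apply/andP; split; lra.
exists 1 => [|t t0 _ V E V_card Ek pert]; first by rewrite ltr01 lexx.
pose i0 := Ordinal t0; have [|P1 P2 _] := pert i0 1%N.
  by move: k3; clear; lia.
exfalso; have [S0|[s /P1]] := set_0Vmem (shadow 1 (at_color E i0)); last first.
  have Ek0 : is_1kgraph k (at_color E i0).
    by move=> e; rewrite mem_at_color => /andP[/Ek].
  by have := reldeg_le1 R s Ek0; lra.
move: P2; rewrite cards1 mul1n bin1 V_card ler_pdivrMr ?ltr0n//.
have : (t <= #|coshadow 1 [set i0] (at_color E i0)|)%N.
  have inj : injective (fun v : V => (i0, [set v])) by move=> v w [/set1_inj].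
  rewrite -{1}V_card -cardsT -(card_imset _ inj).
  apply: subset_leq_card; apply/subsetP => _ /imsetP[v _ ->].
  by rewrite /coshadow S0 setD0 in_set /= set11 cards1.
rewrite -(ler_nat R) => tc h.
have tR : 0 < t%:R :> R by rewrite ltr0n.
have : alpha * t%:R <= 1 / 2 * t%:R by rewrite ler_pM2r.
by move: tc h tR; lra.
Qed.

(** For negative [delta] the empty graph meets the degree condition with a suitable [mu], but the
    links of a framework contain an edge. *)
Lemma rhf_property_ge0 (R : realType) k (delta : R) : rhf_property k delta -> 0
  <= delta.
Proof.
move=> rhfP; rewrite leNgt; apply/negP => d0.
pose mu := Num.min 1 (- delta).
have mu01 : 0 < mu <= 1 by rewrite lt_min ge_min lexx ltr01 oppr_gt0 d0.
have muD : delta + mu <= 0 by rewrite addrC -lerBrDr sub0r ge_min lexx orbT.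
have [gamma /andP[g0 _] Hg] := rhfP mu mu01.
have {Hg} [a0 /andP[a00 a01] Ha] := Hg gamma ltac:(by rewrite g0 lexx).
(* Halving [a0] keeps [alpha] below 1, so that the framework has at least one color. *)
have {Ha} [e0 /andP[e00 e01] He] := Ha (a0 / 2) ltac:(apply/andP; split; lra).
have {He} [T0 /andP[T00 T01] HT] := He e0 ltac:(by rewrite e00 lexx).
pose t := (Num.trunc T0^-1).+1.
have tT : t%:R^-1 <= T0.
  rewrite invf_ple ?posrE ?ltr0n//; exact/ltW/truncnS_gt.
have [] := HT t isT tT 'I_t set0 set0 (card_ord t).
- by move=> e; rewrite inE.
- move=> s _; apply: le_trans muD _; rewrite /reldeg divr_ge0//.
- exact: sub0set.
- by rewrite cards0 !mulr_ge0// ltW.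
move=> t' [V' [f [g [H [[t'T _] _ _ HE [_ _ _ _ share]]]]]].
have t'0 : (0 < t')%N.
  rewrite -(ltr_nat R); apply: lt_le_trans t'T; rewrite mulr_gt0 ?ltr0n//; lra.
have [X [XH _]] := share (Ordinal t'0) (Ordinal t'0).
move: XH; rewrite in_set => /andP[_ /HE].
by rewrite !inE andbF.
Qed.

Theorem theorem1p16 (R : realType) (k : nat) (hk : (3 <= k)%N) :
  rhf R k <= rhv R k.
Proof.
(* Comparing the infima takes a member of the set for [rhv], namely 1, and a lower bound of the set
   for [rhf], namely 0. *)
apply: lb_le_inf.
  by exists 1; split; [|exact: rhv_property1].
move=> delta [delta0 rhvP]; apply: ge_inf; last exact: rhf_property_of_rhv.
by exists 0 => d; exact: rhf_property_ge0.
Qed.
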